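(* Let $N\ge 2$, let $\delta\in\left(-\frac{2}{3\sqrt3},\frac{2}{3\sqrt3}\right)$, and let $u_\delta$ be a solution to $-\Delta u=u-u^3-\delta$ in $\mathbb{R}^N$ such that $u_\delta>z_2(\delta)$ outside a ball $B_R\subset\mathbb{R}^N$, for some $R>0$. Then: (1) If $\delta\in\left(-\frac{2}{3\sqrt3},0\right]$, then $u_\delta\equiv z_3(\delta)$. (2) If $\delta\in\left(0,\frac{2}{3\sqrt3}\right)$, then $u_\delta$ is radially symmetric (not necessarily constant).
   Context: For $\delta\in\left(-\frac{2}{3\sqrt3},\frac{2}{3\sqrt3}\right)$ the polynomial $f_\delta(t)=t-t^3-\delta$ has exactly three real roots, denoted $z_1(\delta)<-\frac1{\sqrt3}<z_2(\delta)<\frac1{\sqrt3}<z_3(\delta)$. Solutions are understood as classical (smooth) solutions on all of $\mathbb{R}^N$. $B_R$ is the ball of radius $R$ centred at the origin. Radially symmetric means radially symmetric up to a translation: there are $x_0\in\mathbb{R}^N$ and a function $w$ with $u_\delta(x)=w(|x-x_0|)$ for all $x\in\mathbb{R}^N$. *)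

(* Defs.v *)
From HB Require Import structures.
From mathcomp Require Import all_boot all_order all_algebra.
From mathcomp Require Import ring lra.
From mathcomp Require Import all_classical all_reals all_analysis.
Set Implicit Arguments.
Unset Strict Implicit.
Unset Printing Implicit Defensive.
Import Order.TTheory GRing.Theory Num.Theory numFieldNormedType.Exports.
Local Open Scope classical_set_scope.
Local Open Scope ring_scope.

Definition f_delta (R : realType) (delta t : R) : R := t - t ^+ 3 - delta.

Definition delta_bound (R : realType) : R := 2 / (3 * Num.sqrt 3).

(* The roots of [f_delta delta], each picked in its own interval; they are the
   intended numbers only for |delta| < delta_bound, see [f_delta_roots]. *)
Definition z1 (R : realType) (delta : R) : R :=
  get [set t : R | t < - (Num.sqrt 3)^-1 /\ f_delta delta t = 0].

Definition z2 (R : realType) (delta : R) : R :=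
  get [set t : R | - (Num.sqrt 3)^-1 < t < (Num.sqrt 3)^-1
                   /\ f_delta delta t = 0].

Definition z3 (R : realType) (delta : R) : R :=
  get [set t : R | (Num.sqrt 3)^-1 < t /\ f_delta delta t = 0].

(* The norm [`|x|] of the library on ['rV[R]_N] is the sup norm. *)
Definition enorm (R : realType) (N : nat) (x : 'rV[R]_N) : R :=
  Num.sqrt (\sum_(i < N) x 0 i ^+ 2).

Definition partial (R : realType) (N : nat) (i : 'I_N) (u : 'rV[R]_N -> R) :
  'rV[R]_N -> R := fun x => 'D_(delta_mx 0 i) u x.

(* All iterated partial derivatives up to order k exist and are continuous;
   the existence clause matters because ['D_v u x] is a total function. *)
Fixpoint is_Ck (R : realType) (N k : nat) (u : 'rV[R]_N -> R) : Prop :=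
  continuous u /\
  if k is k'.+1 then
    forall i : 'I_N, (forall x, derivable u x (delta_mx 0 i)) /\
                     is_Ck k' (partial i u)
  else True.

Definition laplacian (R : realType) (N : nat) (u : 'rV[R]_N -> R)
  (x : 'rV[R]_N) : R := \sum_(i < N) partial i (partial i u) x.

Definition classical_solution (R : realType) (N : nat) (delta : R)
  (u : 'rV[R]_N -> R) : Prop :=
  is_Ck 2 u /\ forall x, - laplacian u x = u x - u x ^+ 3 - delta.

Definition radially_symmetric (R : realType) (N : nat) (u : 'rV[R]_N -> R) :
  Prop :=
  exists (x0 : 'rV[R]_N) (w : R -> R), forall x, u x = w (enorm (x - x0)).

Lemma f_delta_roots (R : realType) (delta : R) :
  - delta_bound R < delta < delta_bound R ->
  [/\ z1 delta < - (Num.sqrt 3)^-1,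
      - (Num.sqrt 3)^-1 < z2 delta < (Num.sqrt 3)^-1,
      (Num.sqrt 3)^-1 < z3 delta
    & forall t : R, f_delta delta t = 0 <->
        [\/ t = z1 delta, t = z2 delta | t = z3 delta]].
Proof.
rewrite /delta_bound => /andP[d1 d2].
set s : R := (Num.sqrt 3)^-1.
have s0 : 0 < s by rewrite invr_gt0 sqrtr_gt0.
have s2 : 3 * s ^+ 2 = 1 by rewrite exprVn sqr_sqrtr // mulfV.
have bE : 2 / (3 * Num.sqrt 3) = 2 / 3 * s :> R by rewrite invfM mulrA.
rewrite bE in d1 d2.
have s1 : s < 1 by nra.
have cf (a b : R) : {within `[a, b], continuous (f_delta delta)}.
  apply: continuous_subspaceT => x.
  apply: cvgB; last exact: cvg_cst.
  by apply: cvgB; [exact: cvg_id|exact: exprn_continuous].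
have ivt (a b : R) : a <= b -> f_delta delta a * f_delta delta b < 0 ->
    exists2 c, a < c < b & f_delta delta c = 0.
  move=> ab fab.
  have [|c] := IVT (v := 0) ab (cf a b).
    rewrite ge_min le_max.
    have [?|?] := lerP (f_delta delta a) 0; have [?|?] := lerP (f_delta delta b) 0;
      rewrite ?orbT //=; nra.
  rewrite in_itv /= => /andP[ac cb] fc; exists c => //.
  rewrite !lt_neqAle ac cb !andbT.
  apply/andP; split; apply/eqP => e; move: fab.
    by rewrite e fc mul0r ltxx.
  by rewrite -e fc mulr0 ltxx.
have s3 : s ^+ 3 = s / 3 by rewrite exprS; nra.
have fs : 0 < f_delta delta s by rewrite /f_delta s3; lra.
have fNs : f_delta delta (- s) < 0.
  have -> : f_delta delta (- s) = - s + s ^+ 3 - delta by rewrite /f_delta; ring.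
  rewrite s3; lra.
have f2 : f_delta delta 2 < 0.
  have -> : f_delta delta 2 = - 6 - delta by rewrite /f_delta; ring.
  lra.
have fN2 : 0 < f_delta delta (- 2).
  have -> : f_delta delta (- 2) = 6 - delta by rewrite /f_delta; ring.
  lra.
have [||a /andP[a1 a2] fa] := ivt (- 2) (- s); [lra|nra|].
have [||b /andP[b1 b2] fb] := ivt (- s) s; [lra|nra|].
have [||c /andP[c1 c2] fc] := ivt s 2; [lra|nra|].
have [z1s z1r] : z1 delta < - s /\ f_delta delta (z1 delta) = 0.
  exact: (@getPex R [set t | t < - s /\ f_delta delta t = 0] (ex_intro _ a (conj a2 fa))).
have [z2s z2r] : - s < z2 delta < s /\ f_delta delta (z2 delta) = 0.
  apply: (@getPex R [set t | - s < t < s /\ f_delta delta t = 0]).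
  by exists b; split => //; apply/andP.
have [z3s z3r] : s < z3 delta /\ f_delta delta (z3 delta) = 0.
  exact: (@getPex R [set t | s < t /\ f_delta delta t = 0] (ex_intro _ c (conj c1 fc))).
split=> // t; split=> [ft|[] ->//].
move: z1s z2s z3s z1r z2r z3r.
move: (z1 delta) (z2 delta) (z3 delta) => p q r ps /andP[q1 q2] rs pr qr rr.
have E : (t - p) * (t - q) * (t - r) = 0.
  have pq : p ^+ 2 + p * q + q ^+ 2 = 1.
    apply: (mulfI (x := p - q)); first by apply/eqP; lra.
    by move: pr qr; rewrite /f_delta => ? ?; lra.
  have qr' : q ^+ 2 + q * r + r ^+ 2 = 1.
    apply: (mulfI (x := q - r)); first by apply/eqP; lra.
    by move: rr qr; rewrite /f_delta => ? ?; lra.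
  have sum0 : p + q + r = 0.
    apply: (mulfI (x := p - r)); first by apply/eqP; lra.
    by lra.
  have rE : r = - p - q by lra.
  have dE : delta = p - p ^+ 3 by move: pr; rewrite /f_delta; lra.
  move: ft; rewrite /f_delta dE rE => ft.
  have -> : (t - p) * (t - q) * (t - (- p - q)) =
    - (t - t ^+ 3 - (p - p ^+ 3)) + (t - p) * (1 - (p ^+ 2 + p * q + q ^+ 2)) by ring.
  by rewrite ft pq; ring.
move/eqP: E; rewrite !mulf_eq0 !subr_eq0 -orbA => /or3P[] /eqP ->;
  by [constructor 1|constructor 2|constructor 3].
Qed.

(* Main.v *)
Require Import Defs.
From mathcomp Require Import all_boot all_order all_algebra.
From mathcomp Require Import ring lra.
From mathcomp Require Import all_classical all_reals all_analysis.
Import Order.TTheory GRing.Theory Num.Theory numFieldNormedType.Exports.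
Local Open Scope classical_set_scope.
Local Open Scope ring_scope.
Set Implicit Arguments.
Unset Strict Implicit.
Unset Printing Implicit Defensive.

(** A Keller-Osserman barrier gives [u <= z3], and comparison with a bump on
    large balls far from the origin, where [u > z2] makes the nonlinearity
    positive, gives [u -> z3] at infinity.  Since [t - t ^ 3] is decreasing for
    [t > 1 / sqrt 3], the method of moving planes then starts from infinity in
    every direction, and stops at a plane of symmetry; instead of the Hopf
    lemma, its continuation step uses an explicit supersolution in a narrow
    strip.  Planes of symmetry orthogonal to the axes make [u] even about a
    point [x0]; a plane missing [x0] would make [u] periodic, hence constant, so
    [u] is radial about [x0].  If [delta <= 0], then [z3] maximizes the potential
    [F t = t^2/2 - t^4/4 - delta t], while the energy [u_r^2/2 + F u] of a radial
    solution is nonincreasing in [r], at most [F z3] at [r = 0], and at least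
    [F z3] in the limit; so it is constant, and its derivative
    [- (N - 1) u_r^2 / r] vanishes. *)

(** * Directional derivatives and Hessians *)

Section Directional.
Context {R : realType} {V : normedModType R}.
Implicit Types (u : V -> R) (x a b v : V).

Lemma MVT_origin (f df : R -> R) (h : R) :
  (forall t : R, is_derive t (1 : R) f (df t)) ->
  exists2 c, `|c| <= `|h| & f h - f 0 = df c * h.
Proof.
move=> fdf.
have cf (p q : R) : {within `[p, q], continuous f}.
  apply: continuous_subspaceT => t.
  by apply/differentiable_continuous/derivable1_diffP.
have [h0|h0|->] := ltgtP h 0.
- have [c + E] := MVT h0 (fun t _ => fdf t) (cf _ _).
  rewrite in_itv /= => /andP[hc c0]; exists c; first by rewrite !ltr0_norm //; lra.
  by lra.
- have [c + E] := MVT h0 (fun t _ => fdf t) (cf _ _).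
  rewrite in_itv /= => /andP[c0 ch]; exists c; first by rewrite !gtr0_norm //; lra.
  by lra.
- by exists 0 => //; rewrite subrr mulr0.
Qed.

Lemma is_derive_line u x v (t : R) : derivable u (x + t *: v) v ->
  is_derive t (1 : R) (fun s : R => u (x + s *: v)) ('D_v u (x + t *: v)).
Proof.
have E : (fun h : R => h^-1 *: (((fun s : R => u (x + s *: v)) \o shift t) (h *: 1) -
    u (x + t *: v)))
  = (fun h => h^-1 *: ((u \o shift (x + t *: v)) (h *: v) - u (x + t *: v))).
  apply/funext => h /=; congr (_ *: (u _ - _)).
  by rewrite [h%:A]mulr1 scalerDl addrCA.
by move=> ud; split; rewrite /derivable /derive E.
Qed.

(** Continuity is built in because derivability along two directions does not by itself give the
    derivative along their sum. *)
Definition C1_along v u :=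
  (forall x, derivable u x v) /\ continuous (fun x => 'D_v u x).

(** Move first by [h *: a], then by [h *: b]: the first quotient converges by hypothesis, and the
    second is, by the mean value theorem, a value of ['D_b u] at a point tending to [x]. *)
Lemma is_deriveD_dir u a b x : derivable u x a -> C1_along b u ->
  is_derive x (a + b) u ('D_a u x + 'D_b u x).
Proof.
move=> ua [ub cb].
suff H : (fun h : R => h^-1 *: ((u \o shift x) (h *: (a + b)) - u x)) @ 0^' -->
    'D_a u x + 'D_b u x.
  by split; [apply/cvg_ex; eexists; exact: H | apply: cvg_lim].
have -> : (fun h : R => h^-1 *: ((u \o shift x) (h *: (a + b)) - u x)) =
  (fun h => h^-1 *: ((u \o shift x) (h *: a) - u x) +
            h^-1 *: (u ((h *: a + x) + h *: b) - u (h *: a + x))).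
  apply/funext => h; rewrite -scalerDr /=; congr (_ *: _).
  by rewrite scalerDr (addrAC (h *: a)) [RHS]addrC subrKA.
apply: cvgD; first exact: ua.
apply/cvgrPdist_lt => e e0.
have /cvgrPdist_lt/(_ e e0)/nbhs_ballP[d /= d0 dP] := cb x.
have M0 : 0 < `|a| + `|b| + 1 by rewrite ltr_wpDl // addr_ge0.
near=> h.
have h0 : h != 0 by near: h; exact: nbhs_dnbhs_neq.
have hd : `|h| < d / (`|a| + `|b| + 1).
  near: h; apply: dnbhs0_lt; exact: divr_gt0.
have [c ch E] := MVT_origin h (fun t => is_derive_line (ub (h *: a + x + t *: b))).
have -> : h^-1 *: (u (h *: a + x + h *: b) - u (h *: a + x)) =
    'D_b u (h *: a + x + c *: b).
  by move: E; rewrite scale0r addr0 => ->; rewrite /GRing.scale /= mulrC mulfK.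
apply: dP; rewrite -ball_normE /=.
rewrite (addrC (h *: a)) -addrA opprD addrA subrr sub0r normrN.
apply: le_lt_trans (ler_normD _ _) _; rewrite !normrZ.
apply: (@le_lt_trans _ _ (`|h| * (`|a| + `|b| + 1))).
  by have := normr_ge0 a; have := normr_ge0 b; have := normr_ge0 h; nra.
by rewrite -ltr_pdivlMr.
Unshelve. all: by end_near. Qed.

Lemma is_deriveZ_dir u (c : R) a x : derivable u x a ->
  is_derive x (c *: a) u (c * 'D_a u x).
Proof.
have [-> _|c0 ua] := eqVneq c 0.
  by rewrite scale0r mul0r; exact: is_derive0.
pose g (s : R) := u (x + (c * s) *: a).
have [L1 L2] : is_derive (0 : R) (1 : R) g (c * 'D_a u x).
  rewrite [X in is_derive _ _ _ X]mulrC.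
  apply: (@is_derive1_comp _ (fun s : R => u (x + s *: a)) (fun s => c * s)).
    have := is_derive_line (u := u) (x := x) (v := a) (t := c * 0).
    by rewrite mulr0 scale0r addr0; apply.
  apply: is_derive_eq (@is_deriveZ R R R id c 0 1 1 (is_derive_id _ _)) _.
  exact: mulr1.
have E : (fun h : R => h^-1 *: ((g \o shift 0) (h *: 1) - g 0)) =
    (fun h : R => h^-1 *: ((u \o shift x) (h *: (c *: a)) - u x)).
  apply/funext => h; rewrite /g /= mulr0 scale0r addr0 addr0.
  congr (_ *: (u _ - _)).
  by rewrite [h%:A]mulr1 scalerA addrC mulrC.
by move: L1 L2; rewrite /derivable /derive E => L1 L2; split.
Qed.

Lemma C1_alongD a b u : C1_along a u -> C1_along b u -> C1_along (a + b) u.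
Proof.
move=> [ua ca] ub; have H x := is_deriveD_dir (ua x) ub.
split=> [x|]; first by have [] := H x.
under eq_fun do rewrite derive_val.
by move=> x; apply: cvgD; [exact: ca|exact: ub.2].
Qed.

Lemma C1_alongZ c a u : C1_along a u -> C1_along (c *: a) u.
Proof.
move=> [ua ca]; have H x := is_deriveZ_dir c (ua x).
split=> [x|]; first by have [] := H x.
under eq_fun do rewrite derive_val.
by move=> x; apply: cvgM; [exact: cvg_cst|exact: ca].
Qed.

Lemma C1_along0 u : C1_along 0 u.
Proof.
split=> [x|]; first exact: derivable0.
by under eq_fun do rewrite derive0; exact: cst_continuous.
Qed.

Lemma derive_dirD a b u x : C1_along a u -> C1_along b u ->
  'D_(a + b) u x = 'D_a u x + 'D_b u x.
Proof. by move=> [ua _] ub; have [_ ->] := is_deriveD_dir (ua x) ub. Qed.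

Lemma derive_dirZ a u (c : R) x : C1_along a u -> 'D_(c *: a) u x = c * 'D_a u x.
Proof. by move=> [ua _]; have [_ ->] := is_deriveZ_dir c (ua x). Qed.

(** All directions are included, not only the coordinate ones, since a reflection sends coordinate
    lines to lines of arbitrary direction. *)
Definition C2 u := forall a, C1_along a u /\ forall b, C1_along b ('D_a u).

Definition hess u x a b := 'D_b ('D_a u) x.

Lemma hessDr u x a b c : C2 u -> hess u x a (b + c) = hess u x a b + hess u x a c.
Proof. by move=> /(_ a)[_ H]; exact: derive_dirD. Qed.

Lemma hessZr u x a b (c : R) : C2 u -> hess u x a (c *: b) = c * hess u x a b.
Proof. by move=> /(_ a)[_ H]; exact: derive_dirZ. Qed.

Lemma hessDl u x a b c : C2 u -> hess u x (a + b) c = hess u x a c + hess u x b c.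
Proof.
move=> uC; have [Ca /(_ c)[ac _]] := uC a; have [Cb /(_ c)[bc _]] := uC b.
have E : 'D_(a + b) u = 'D_a u + 'D_b u by apply/funext => y; exact: derive_dirD.
by rewrite /hess E deriveD.
Qed.

Lemma hessZl u x a b (c : R) : C2 u -> hess u x (c *: a) b = c * hess u x a b.
Proof.
move=> uC; have [Ca /(_ b)[ab _]] := uC a.
have E : 'D_(c *: a) u = c *: 'D_a u by apply/funext => y; exact: derive_dirZ.
by rewrite /hess E deriveZ.
Qed.

Lemma C1_along_addf v (f g : V -> R) :
  C1_along v f -> C1_along v g -> C1_along v (f + g).
Proof.
move=> [fd fc] [gd gc]; split=> [x|]; first exact: derivableD.
under eq_fun do rewrite deriveD //.
by move=> x; apply: cvgD; [exact: fc|exact: gc].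
Qed.

Lemma C1_along_scalef v (c : R) (f : V -> R) : C1_along v f -> C1_along v (c *: f).
Proof.
move=> [fd fc]; split=> [x|]; first exact: derivableZ.
under eq_fun do rewrite deriveZ //.
by move=> x; apply: cvgM; [exact: cvg_cst|exact: fc].
Qed.

End Directional.

(** * Euclidean geometry and pointwise second derivatives *)

Section Euclid.
Context {R : realType} {N : nat}.
Notation V := 'rV[R]_N.
Implicit Types (x y z a e : V).

Definition dot x y : R := \sum_i x 0 i * y 0 i.
(** The square of [enorm]; unlike [enorm] it is polynomial, hence smooth at the origin. *)
Definition sq x := dot x x.

Lemma dotC x y : dot x y = dot y x.
Proof. by apply: eq_bigr => i _; rewrite mulrC. Qed.
Lemma dotDl x y z : dot (x + y) z = dot x z + dot y z.
Proof. by rewrite -big_split /=; apply: eq_bigr => i _; rewrite mxE mulrDl. Qed.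
Lemma dotZl c x z : dot (c *: x) z = c * dot x z.
Proof. by rewrite mulr_sumr; apply: eq_bigr => i _; rewrite mxE mulrA. Qed.
Lemma dotNl x z : dot (- x) z = - dot x z.
Proof. by rewrite -scaleN1r dotZl mulN1r. Qed.
Lemma dotBl x y z : dot (x - y) z = dot x z - dot y z.
Proof. by rewrite dotDl dotNl. Qed.
Lemma dotDr x y z : dot z (x + y) = dot z x + dot z y.
Proof. by rewrite dotC dotDl !(dotC z). Qed.
Lemma dotZr c x z : dot z (c *: x) = c * dot z x.
Proof. by rewrite dotC dotZl (dotC z). Qed.
Lemma dotNr x z : dot z (- x) = - dot z x.
Proof. by rewrite dotC dotNl (dotC z). Qed.
Lemma dotBr x y z : dot z (x - y) = dot z x - dot z y.
Proof. by rewrite dotDr dotNr. Qed.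
Definition dotE := (dotDl, dotDr, dotNl, dotNr, dotZl, dotZr).

Lemma sq_ge0 x : 0 <= sq x.
Proof. by apply: sumr_ge0 => i _; rewrite -expr2 sqr_ge0. Qed.

Lemma coord_sq_le x i : x 0 i ^+ 2 <= sq x.
Proof.
rewrite /sq /dot (bigD1 i) //= -expr2 lerDl.
by apply: sumr_ge0 => j _; rewrite -expr2 sqr_ge0.
Qed.

Lemma sq_eq0 x : sq x = 0 -> x = 0.
Proof.
move=> x0; apply/rowP => i; rewrite mxE; apply/eqP; rewrite -sqrf_eq0 eq_le sqr_ge0.
by rewrite andbT -x0 coord_sq_le.
Qed.

Lemma sq_gt0 x : x != 0 -> 0 < sq x.
Proof.
by move=> x0; rewrite lt_neqAle sq_ge0 andbT eq_sym; apply: contraNneq x0 => /sq_eq0 ->.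
Qed.

Lemma sqN x : sq (- x) = sq x.
Proof. by rewrite /sq !dotE opprK. Qed.

Lemma sqZ c x : sq (c *: x) = c ^+ 2 * sq x.
Proof. by rewrite /sq !dotE mulrA expr2. Qed.

Lemma sqD x y : sq (x + y) = sq x + 2 * dot x y + sq y.
Proof. rewrite /sq !dotE (dotC y x); ring. Qed.

Lemma sqB x y : sq (x - y) = sq x - 2 * dot x y + sq y.
Proof. by rewrite sqD sqN dotNr; ring. Qed.

Lemma dot_unit_le x e : sq e = 1 -> dot x e ^+ 2 <= sq x.
Proof.
move=> e1; have := sq_ge0 (x - dot x e *: e).
by rewrite sqB sqZ e1 dotZr; lra.
Qed.

Lemma enorm_sqE x : enorm x = Num.sqrt (sq x).
Proof. by congr Num.sqrt; apply: eq_bigr => i _; rewrite expr2. Qed.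

Lemma le_enorm (r : R) x : 0 <= r -> (r <= enorm x) = (r ^+ 2 <= sq x).
Proof.
move=> r0; rewrite enorm_sqE -{1}(ger0_norm r0) -sqrtr_sqr ler_sqrt //.
exact: sq_ge0.
Qed.

Lemma dot_delta x i : dot x (delta_mx 0 i) = x 0 i.
Proof.
rewrite /dot (bigD1 i) //= mxE !eqxx mulr1 big1 ?addr0 // => j ji.
by rewrite mxE (negPf ji) andbF mulr0.
Qed.

Lemma sq_delta i : sq (delta_mx 0 i : V) = 1.
Proof. by rewrite /sq dot_delta mxE !eqxx. Qed.

Lemma dot_continuous (T : topologicalType) (f g : T -> V) :
  continuous f -> continuous g -> continuous (fun t => dot (f t) (g t)).
Proof.
move=> cf cg; rewrite /dot; elim: (index_enum _) => [|i r IHr] t.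
  by under eq_fun do rewrite big_nil; exact: cst_continuous.
under eq_fun do rewrite big_cons; apply: cvgD; last exact: IHr.
apply: cvgM.
  exact: (continuous_comp (cf t) (@coord_continuous _ _ _ 0 i _)).
exact: (continuous_comp (cg t) (@coord_continuous _ _ _ 0 i _)).
Qed.

Lemma sq_continuous (T : topologicalType) (f : T -> V) :
  continuous f -> continuous (fun t => sq (f t)).
Proof. by move=> cf; exact: dot_continuous. Qed.

Lemma sq_bounded_compact (A : set V) (r : R) :
  closed A -> (forall x, A x -> sq x <= r) -> compact A.
Proof.
move=> cA Ar; apply: bounded_closed_compact => //.
exists (1 + r); split; first exact: num_real.
move=> M rM x Ax; rewrite /= [leLHS]/Num.norm /= mx_normrE.
have := sq_ge0 x; have := Ar _ Ax => xr x0.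
apply: bigmax_le; first lra.
move=> [i j] _ /=; rewrite (ord1 i).
by have := coord_sq_le x j; rewrite -real_normK ?num_real //; nra.
Qed.

End Euclid.
Arguments sq_ge0 {R N} x.

Section SecondOrder.
Context {R : realType}.

(** A second derivative at [0] that asks for differentiability only near [0], so that barriers
    smooth only locally qualify. *)
Definition is_deriv2 (f : R -> R) (d : R) := exists2 f1 : R -> R,
  (\forall t \near 0, is_derive t (1 : R) f (f1 t)) & is_derive (0 : R) (1 : R) f1 d.

Lemma is_deriv2D f g df dg : is_deriv2 f df -> is_deriv2 g dg ->
  is_deriv2 (fun t => f t + g t) (df + dg).
Proof.
move=> [f1 ff1 f1d] [g1 gg1 g1d]; exists (f1 + g1); last exact: is_deriveD.
by near=> t; apply: is_deriveD; near: t.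
Unshelve. all: by end_near. Qed.

Lemma is_deriv2Z f (c d : R) : is_deriv2 f d -> is_deriv2 (fun t => c * f t) (c * d).
Proof.
move=> [f1 ff1 f1d]; exists (c *: f1); last exact: is_deriveZ.
by near=> t; apply: is_deriveZ; near: t.
Unshelve. all: by end_near. Qed.

(** If [d < 0], then near [0] the sign of [f1 t - f1 0] is opposite to that of [t]; whatever the
    sign of [f1 0], the mean value theorem then puts [f] below [f 0] on one side. *)
Lemma is_deriv2_min_ge0 (f : R -> R) (d : R) :
  is_deriv2 f d -> (\forall t \near 0, f 0 <= f t) -> 0 <= d.
Proof.
move=> [f1 ff1 [f1c f1d]] fmin; rewrite leNgt; apply/negP => d0.
have : \forall h \near (0 : R)^', h^-1 *: (f1 (h *: 1 + 0) - f1 0) < 0.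
  by apply: (cvgr_lt d) d0; rewrite -f1d; exact: f1c.
rewrite near_withinE => f1h.
have /nbhs_norm0P[e /= e0 eP] : \forall t \near (0 : R),
  is_derive t (1 : R) f (f1 t) /\ f 0 <= f t /\ (t != 0 -> t^-1 *: (f1 (t *: 1 + 0) - f1 0) < 0).
  by near=> t; split; [near: t|split; near: t].
have key (t : R) : `|t| < e -> t != 0 -> t^-1 * (f1 t - f1 0) < 0.
  by move=> te t0; have [_ [_ /(_ t0)]] := eP _ te; rewrite [_ *: 1]mulr1 addr0.
have cf (p q : R) : - e < p -> q < e -> {within `[p, q], continuous f}.
  move=> ep qe; apply: derivable_within_continuous => t; rewrite in_itv /= => /andP[pt tq].
  by have [|[]//] := eP t; rewrite /= ltr_norml; lra.
have [f10|f10] := lerP (f1 0) 0.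
- have [|t||t + E] := @MVT R f f1 0 (e / 2); [lra| | |].
  + rewrite in_itv /= => /andP[t0 te].
    by have [|//] := eP t; rewrite /= ltr_norml; lra.
  + by apply: cf; lra.
  rewrite in_itv /= => /andP[t0 te].
  have [|_ [fe _]] := eP (e / 2); first by rewrite /= ltr_norml; lra.
  have := key t; rewrite pmulr_rlt0 ?invr_gt0 // ltr_norml gt_eqF // => /(_ _ isT) k.
  have : f1 t - f1 0 < 0 by apply: k; lra.
  by nra.
- have [|t||t + E] := @MVT R f f1 (- (e / 2)) 0; [lra| | |].
  + rewrite in_itv /= => /andP[t0 te].
    by have [|//] := eP t; rewrite /= ltr_norml; lra.
  + by apply: cf; lra.
  rewrite in_itv /= => /andP[te t0].
  have [|_ [fe _]] := eP (- (e / 2)); first by rewrite /= ltr_norml; lra.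
  have := key t; rewrite nmulr_rlt0 ?invr_lt0 // ltr_norml lt_eqF // => /(_ _ isT) k.
  have : 0 < f1 t - f1 0 by apply: k; lra.
  by nra.
Unshelve. all: by end_near. Qed.

End SecondOrder.

(** * Pointwise Laplacians *)

Section Laplacian.
Context {R : realType} {N : nat}.
Notation V := 'rV[R]_N.
Implicit Types (u w : V -> R) (x y p e : V).

(** A relation, in contrast to the total function [laplacian]: it carries the existence of the
    second derivatives, and it applies to functions smooth only near [y]. *)
Definition is_lap w y (L : R) := exists2 d : 'I_N -> R,
  forall i, is_deriv2 (fun t : R => w (y + t *: delta_mx 0 i)) (d i) & L = \sum_i d i.

Lemma is_lapD u w y (Lu Lw : R) : is_lap u y Lu -> is_lap w y Lw ->
  is_lap (fun x => u x + w x) y (Lu + Lw).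
Proof.
move=> [du du2 ->] [dw dw2 ->]; exists (fun i => du i + dw i); last by rewrite big_split.
by move=> i; apply: is_deriv2D.
Qed.

Lemma is_lapZ w y (c L : R) : is_lap w y L -> is_lap (fun x => c * w x) y (c * L).
Proof.
move=> [d d2 ->]; exists (fun i => c * d i); last by rewrite mulr_sumr.
by move=> i; apply: is_deriv2Z.
Qed.

Lemma is_lapB u w y (Lu Lw : R) : is_lap u y Lu -> is_lap w y Lw ->
  is_lap (fun x => u x - w x) y (Lu - Lw).
Proof.
move=> uL /(is_lapZ (-1)) wL; have := is_lapD uL wL.
by rewrite mulN1r; under eq_fun do rewrite mulN1r.
Qed.

Lemma cvg_line y a : (fun t : R => y + t *: a) @ 0 --> y.
Proof.
rewrite -[X in _ --> X]addr0 -[X in _ + X](scale0r a).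
by apply: cvgD; [exact: cvg_cst|apply: cvgZr_tmp; exact: cvg_id].
Qed.

Lemma is_lap_cst (c : R) y : is_lap (fun=> c) y 0.
Proof.
exists (fun=> 0); last by rewrite big1.
by move=> i; exists (fun=> 0); [near=> t; exact: is_derive_cst|exact: is_derive_cst].
Unshelve. all: by end_near. Qed.

Lemma is_lap_min_ge0 w y (L : R) :
  is_lap w y L -> (\forall x \near y, w y <= w x) -> 0 <= L.
Proof.
move=> [d d2 ->] wmin; apply: sumr_ge0 => i _; apply: is_deriv2_min_ge0 (d2 i) _.
by rewrite scale0r addr0; have H := @cvg_line y (delta_mx 0 i) _ wmin; exact: H.
Qed.

Lemma is_deriv2_C2 u x a : C2 u ->
  is_deriv2 (fun t : R => u (x + t *: a)) (hess u x a a).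
Proof.
move=> uC; have [[ua _] /(_ a)[uaa _]] := uC a.
exists (fun t => 'D_a u (x + t *: a)).
  by near=> t; exact: is_derive_line.
have := is_derive_line (u := 'D_a u) (x := x) (v := a) (t := 0).
by rewrite scale0r addr0; apply.
Unshelve. all: by end_near. Qed.

Lemma is_lap_C2 u x : C2 u -> is_lap u x (laplacian u x).
Proof.
by move=> uC; exists (fun i => hess u x (delta_mx 0 i) (delta_mx 0 i)) => // i;
  exact: is_deriv2_C2.
Qed.

(** For a unit vector [e], the reflection in the hyperplane [dot x e = l]. *)
Definition mirror e (l : R) x : V := x - (2 * (dot x e - l)) *: e.

Lemma mirror_line e l x a (t : R) :
  mirror e l (x + t *: a) = mirror e l x + t *: (a - (2 * dot a e) *: e).
Proof.
rewrite /mirror dotDl dotZl scalerBr scalerA addrACA -opprD -scalerDl.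
by congr (_ - _ *: _); ring.
Qed.

(* No symmetry of [h] is needed: the cross terms sum to [- 4 * h e e] and the
   quadratic one to [4 * h e e]. *)
Lemma trace_reflection (h : V -> V -> R) e :
  (forall a b c, h (a + b) c = h a c + h b c) ->
  (forall a b c, h c (a + b) = h c a + h c b) ->
  (forall (k : R) a b, h (k *: a) b = k * h a b) ->
  (forall (k : R) a b, h b (k *: a) = k * h b a) ->
  sq e = 1 ->
  let a i := delta_mx 0 i in
  \sum_i h (a i - (2 * e 0 i) *: e) (a i - (2 * e 0 i) *: e) = \sum_i h (a i) (a i).
Proof.
move=> hDl hDr hZl hZr e1 a.
have suml b : h e b = \sum_i e 0 i * h (a i) b.
  rewrite [in LHS](row_sum_delta e).
  rewrite (big_morph (h ^~ b) (fun x y => hDl x y b) (id1 := 0)).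
    by apply: eq_bigr => i _; rewrite hZl.
  by rewrite -(scale0r (0 : V)) hZl mul0r.
have sumr b : h b e = \sum_i e 0 i * h b (a i).
  rewrite [in LHS](row_sum_delta e).
  rewrite (big_morph (h b) (fun x y => hDr x y b) (id1 := 0)).
    by apply: eq_bigr => i _; rewrite hZr.
  by rewrite -(scale0r (0 : V)) hZr mul0r.
transitivity (\sum_i (h (a i) (a i) + (- 2) * (e 0 i * h (a i) e) +
     (- 2) * (e 0 i * h e (a i)) + 4 * h e e * (e 0 i * e 0 i))).
  apply: eq_bigr => i _; rewrite -scaleNr hDl !hDr !hZl !hZr; ring.
rewrite !big_split /= -!mulr_sumr -suml -sumr -/(dot e e) -/(sq e) e1; ring.
Qed.

(** On a coordinate line the reflected function is [u] along the reflected basis vector, so its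
    Laplacian is the trace of the Hessian in a reflected frame. *)
Lemma is_lap_mirror u e (l : R) x : C2 u -> sq e = 1 ->
  is_lap (fun y => u (mirror e l y)) x (laplacian u (mirror e l x)).
Proof.
move=> uC e1; set y := mirror e l x.
exists (fun i => hess u y (delta_mx 0 i - (2 * e 0 i) *: e)
                          (delta_mx 0 i - (2 * e 0 i) *: e)).
  move=> i; under eq_fun do rewrite mirror_line dotC dot_delta; exact: is_deriv2_C2.
apply/esym/(trace_reflection (h := hess u y)) => //.
- by move=> a b c; exact: hessDl.
- by move=> a b c; exact: hessDr.
- by move=> k a b; exact: hessZl.
- by move=> k a b; exact: hessZr.
Qed.

(** Linearity in the direction extends regularity from the basis vectors to all vectors, for [u] and
    for its first derivatives. *)
Lemma is_Ck2_C2 u : is_Ck 2 u -> C2 u.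
Proof.
move=> [_ uC].
pose P a := C1_along a u /\ forall b, C1_along b ('D_a u).
have along (f : V -> R) : (forall i : 'I_N, C1_along (delta_mx 0 i) f) -> forall a, C1_along a f.
  move=> fi a; rewrite (row_sum_delta a).
  elim/big_ind: _ => [|b c|i _]; [exact: C1_along0|exact: C1_alongD|exact: C1_alongZ].
have PD a b : P a -> P b -> P (a + b).
  move=> [ua Da] [ub Db]; split=> [|c]; first exact: C1_alongD.
  have -> : 'D_(a + b) u = 'D_a u + 'D_b u by apply/funext => y; exact: derive_dirD.
  exact: C1_along_addf (Da c) (Db c).
have PZ (c : R) a : P a -> P (c *: a).
  move=> [ua Da]; split=> [|b]; first exact: C1_alongZ.
  have -> : 'D_(c *: a) u = c *: 'D_a u by apply/funext => y; exact: derive_dirZ.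
  exact: C1_along_scalef (Da b).
have Pi i : P (delta_mx 0 i).
  have [ud [cd Dd]] := uC i; split.
    by apply: along => j; have [uj [cj _]] := uC j; exact: conj uj cj.
  by apply: along => j; have [dj [cj _]] := Dd j; exact: conj dj cj.
move=> a; rewrite (row_sum_delta a).
elim/big_ind: _ => [|b c|i _]; [|exact: PD|exact/PZ].
split=> [|b]; first exact: C1_along0.
have -> : 'D_(0 : V) u = cst 0 by apply/funext => y; exact: derive0.
split=> [y|]; first exact: derivable_cst.
by under eq_fun do rewrite derive_cst; exact: cst_continuous.
Qed.

(** On a coordinate line the squared distance to [p] is [s + 2 * c * t + t ^+ 2], so each direction
    contributes [2 * psi1 s + 4 * c ^+ 2 * psi2], and the [c ^+ 2] add up to [s]. *)
Lemma is_lap_radial (psi psi1 : R -> R) (psi2 : R) p y :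
  (\forall s \near sq (y - p), is_derive s (1 : R) psi (psi1 s)) ->
  is_derive (sq (y - p)) (1 : R) psi1 psi2 ->
  is_lap (fun x => psi (sq (x - p))) y
    (2 * N%:R * psi1 (sq (y - p)) + 4 * sq (y - p) * psi2).
Proof.
set s := sq (y - p) => psiD psi1D.
exists (fun i => 2 * psi1 s + 4 * (y - p) 0 i ^+ 2 * psi2); last first.
  rewrite big_split /= sumr_const card_ord -mulr_suml -mulr_sumr.
  rewrite (_ : \sum_i _ = s); last by apply: eq_bigr => i _; rewrite expr2.
  by rewrite -[_ *+ N]mulr_natr; ring.
move=> i; set c := (y - p) 0 i.
pose q (t : R) := s + 2 * c * t + t ^+ 2.
have qE t : sq (y + t *: delta_mx 0 i - p) = q t.
  by rewrite addrAC sqD sqZ sq_delta dotZr dot_delta /q -/s -/c; ring.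
under eq_fun do rewrite qE.
have qD (t : R) : is_derive t (1 : R) q (2 * c + 2 * t).
  apply: trigger_derive; rewrite /GRing.scale /=; ring.
have q0 : q 0 = s by rewrite /q mulr0 expr0n /= !addr0.
exists (fun t => psi1 (q t) * (2 * c + 2 * t)).
  have cq : q @ 0 --> s.
    rewrite -q0; apply/differentiable_continuous/derivable1_diffP.
    by have [] := qD 0.
  near=> t; apply: (@is_derive1_comp _ psi q) => //; near: t.
  exact: (cq _ psiD).
have psiq : is_derive (0 : R) (1 : R) (psi1 \o q) (psi2 * (2 * c + 2 * 0)).
  by apply: is_derive1_comp; rewrite ?q0.
have lin : is_derive (0 : R) (1 : R) (fun t : R => 2 * c + 2 * t) 2.
  apply: trigger_derive; rewrite /GRing.scale /=; ring.
apply: is_derive_eq (is_deriveM psiq lin) _.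
rewrite /GRing.scale /= q0; ring.
Unshelve. all: by end_near. Qed.

End Laplacian.

(** * Comparison principles *)

Section MaximumPrinciples.
Context {R : realType} {N : nat}.
Notation V := 'rV[R]_N.
Implicit Types (u w L : V -> R) (x y p : V).

Lemma continuous_subf (T : topologicalType) (f g : T -> R) :
  continuous f -> continuous g -> continuous (fun t => f t - g t).
Proof. by move=> cf cg t; apply: cvgB; [exact: cf|exact: cg]. Qed.

Lemma continuous_mulf (T : topologicalType) (f g : T -> R) :
  continuous f -> continuous g -> continuous (fun t => f t * g t).
Proof. by move=> cf cg t; apply: cvgM; [exact: cf|exact: cg]. Qed.

Lemma near_lt (T : topologicalType) (f g : T -> R) (z : T) :
  continuous f -> continuous g -> f z < g z -> \forall t \near z, f t < g t.
Proof.
move=> cf cg fg; have c : (fun t => f t - g t) @ z --> f z - g z.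
  exact: continuous_subf.
have fg0 : f z - g z < 0 by rewrite subr_lt0.
by apply: filterS (cvgr_lt _ c _ fg0) => t; rewrite subr_lt0.
Qed.

Lemma closed_le_fun (T : topologicalType) (f g : T -> R) :
  continuous f -> continuous g -> closed [set t | f t <= g t].
Proof.
move=> cf cg; rewrite (_ : [set t | _] = (fun t => f t - g t) @^-1` [set t | t <= 0]).
  apply: preimage_closed; last exact: closed_le.
  by move=> t _; exact: continuous_subf.
by apply/seteqP; split=> t /=; rewrite subr_le0.
Qed.

Lemma sqB_continuous p : continuous (fun x => sq (x - p)).
Proof.
apply: sq_continuous => x.
by apply: (@cvgB _ V _ (nbhs x) _ id (cst p)); [exact: cvg_id|exact: cvg_cst].
Qed.

Lemma max_on_compact (A : set V) (f : V -> R) x0 : compact A -> A x0 -> continuous f ->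
  exists2 y, A y & forall x, A x -> f x <= f y.
Proof.
move=> cA Ax0 cf.
have [|y Ay yP] := compact_EVT_max (f := f) _ cA (continuous_subspaceT cf).
  by exists x0.
by exists y; [rewrite inE in Ay|move=> x Ax; apply: yP; rewrite inE].
Qed.

Lemma min_on_compact (A : set V) (f : V -> R) x0 : compact A -> A x0 -> continuous f ->
  exists2 y, A y & forall x, A x -> f y <= f x.
Proof.
move=> cA Ax0 cf.
have [|y Ay yP] := compact_EVT_min (f := f) _ cA (continuous_subspaceT cf).
  by exists x0.
by exists y; [rewrite inE in Ay|move=> x Ax; apply: yP; rewrite inE].
Qed.

Lemma sqB_le p x (r : R) : 0 <= r -> sq (x - p) <= r -> sq x <= 2 * r + 2 * sq p.
Proof.
move=> r0 xr; have := sq_ge0 (x - p - p).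
have -> : sq (x - p - p) = sq (x - p) - 2 * dot (x - p) p + sq p by rewrite sqB.
have -> : sq x = sq (x - p) + 2 * dot (x - p) p + sq p by rewrite -sqD subrK.
by lra.
Qed.

Lemma ball_compact p (r : R) : 0 <= r -> compact [set x | sq (x - p) <= r].
Proof.
move=> r0; apply: (@sq_bounded_compact _ _ _ (2 * r + 2 * sq p)).
  apply: (@closed_le_fun V (fun x => sq (x - p)) (cst r)).
    exact: sqB_continuous.
  exact: cst_continuous.
by move=> x /= xr; exact: sqB_le.
Qed.

Lemma nbhs_sq p (P : V -> Prop) : (\forall x \near p, P x) ->
  exists2 s : R, 0 < s & forall x, sq (x - p) <= s -> P x.
Proof.
move=> /nbhs_ballP[e /= e0 eP]; exists ((e / 2) ^+ 2); first by rewrite exprn_gt0 // divr_gt0.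
move=> x xs; apply: eP; rewrite -ball_normE /= distrC.
suff : `|x - p| <= e / 2 by lra.
rewrite /Num.norm /= mx_normrE; apply: bigmax_le; first lra.
move=> [i j] _; rewrite (ord1 i).
have := le_trans (coord_sq_le (x - p) j) xs.
rewrite -(real_normK (num_real ((x - p) 0 j))) ler_sqr ?nnegrE ?normr_ge0 //.
by rewrite divr_ge0 // ltW.
Qed.

(* Keller-Osserman: [1 / (r - |x - x0|^2)], suitably scaled, is a supersolution
   of [lap h = h ^ 3] that blows up on the boundary of every ball. *)
Lemma keller_osserman u L (c : R) : continuous u ->
  (forall x, is_lap u x (L x)) ->
  (forall x, c < u x -> (u x - c) ^+ 3 <= L x) -> forall x, u x <= c.
Proof.
move=> cu uL Lc x0; rewrite leNgt; apply/negP => cx0.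
set h := u x0 - c; have h0 : 0 < h by rewrite subr_gt0.
set K : R := 2 * N%:R + 8; have K0 : 8 <= K by rewrite lerDr mulr_ge0.
(* This squared radius makes [h ^+ 2 * r = K + 1], whereas the comparison at the touching point
   below yields [h ^+ 2 * r <= K]. *)
pose r := (K + 1) / h ^+ 2.
have h20 : 0 < h ^+ 2 by rewrite exprn_gt0.
have r0 : 0 < r by rewrite divr_gt0 //; lra.
have rh : h ^+ 2 * r = K + 1 by rewrite /r mulrC divfK // gt_eqF.
pose S x := sq (x - x0).
have cS : continuous S := @sqB_continuous x0.
have S0 : S x0 = 0 by rewrite /S subrr /sq -(scale0r (0 : V)) dotZl mul0r.
(* The maximum [q] of this product is the least factor for which [q / (r - S)] lies above [u - c];
   the two touch at [y], which is interior because the product vanishes on the sphere. *)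
have [|||y yr ymax] := @max_on_compact [set x | sq (x - x0) <= r]
    (fun x => (u x - c) * (r - S x)) x0.
- by apply: ball_compact; exact: ltW.
- by rewrite /= -/(S x0) S0 ltW.
- apply: continuous_mulf; apply: continuous_subf => //; exact: cst_continuous.
have := ymax x0; rewrite /= -/(S x0) S0 subr0 -/h => /(_ (ltW r0)).
set q := (u y - c) * (r - S y) => hrq.
have q0 : 0 < q by apply: lt_le_trans hrq; rewrite mulr_gt0.
set P := r - S y.
have P0 : 0 < P.
  rewrite lt_neqAle subr_ge0 yr andbT; apply: contraTneq q0 => P0.
  by rewrite /q -/P -P0 mulr0 ltxx.
have uyE : u y - c = q / P by rewrite /q mulfK // gt_eqF.
have uyc : c < u y by rewrite -subr_gt0 uyE divr_gt0.
have psiD : \forall s \near S y, is_derive s (1 : R) (fun s => (r - s)^-1) ((r - s) ^- 2).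
  have : \forall s \near S y, s < r.
    by apply: lt_nbhsl; rewrite -subr_gt0.
  apply: filterS => s sr; have rs : r - s != 0 by rewrite gt_eqF // subr_gt0.
  have D : is_derive s (1 : R) (fun s => r - s) (-1) by apply: trigger_derive; ring.
  apply: is_derive_eq (@is_deriveV _ (fun s => r - s) _ _ _ rs D) _.
  by rewrite /GRing.scale /= mulrNN mulr1.
have psiDD : is_derive (S y) (1 : R) (fun s => (r - s) ^- 2) (2 * P ^- 3).
  have D : is_derive (S y) (1 : R) (fun s => (r - s) ^+ 2) (- 2 * P).
    by apply: trigger_derive; rewrite /GRing.scale /= -/P; ring.
  have rs : P ^+ 2 != 0 by rewrite expf_neq0 // gt_eqF.
  apply: is_derive_eq (@is_deriveV _ (fun s => (r - s) ^+ 2) _ _ _ rs D) _.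
  by rewrite /GRing.scale /= -/P; field; rewrite gt_eqF.
have psiL := is_lap_radial psiD psiDD.
have := is_lap_min_ge0 (is_lapB (is_lapZ q psiL) (uL y)).
have near_min : \forall x \near y, q * (r - sq (y - x0))^-1 - u y <= q * (r - sq (x - x0))^-1 - u x.
  have : \forall x \near y, S x < r.
    by apply: near_lt; [exact: cS|exact: cst_continuous|rewrite -subr_gt0].
  apply: filterS => x xr; have rx : 0 < r - S x by rewrite subr_gt0.
  rewrite -/(S y) -/P -uyE -/(S x).
  have : u x - c <= q * (r - S x)^-1.
    by rewrite ler_pdivlMr //; apply: ymax; exact: ltW.
  by lra.
move=> /(_ near_min); have := Lc _ uyc; rewrite uyE -/(S y) -/P.
have Sy0 : 0 <= S y := sq_ge0 _.
have -> : S y = r - P by rewrite /P; ring.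
have Pr : P <= r by rewrite /P; lra.
rewrite /K in K0 rh.
move: (L y) (N%:R : R) (ler0n R N) K0 rh => Ly n n0 K0 rh Lq Ll.
have : (q / P) ^+ 3 <= q * (2 * n * P ^- 2 + 4 * (r - P) * (2 * P ^- 3)) by lra.
have -> : (q / P) ^+ 3 = q * q ^+ 2 / P ^+ 3 by field; rewrite gt_eqF.
have -> : q * (2 * n * P ^- 2 + 4 * (r - P) * (2 * P ^- 3)) =
    q * (2 * n * P + 8 * (r - P)) / P ^+ 3 by field; rewrite gt_eqF.
rewrite ler_pM2r ?invr_gt0 ?exprn_gt0 // ler_pM2l // => qK.
have : (h * r) ^+ 2 <= q ^+ 2.
  by rewrite ler_pXn2r // nnegrE ltW // mulr_gt0.
rewrite exprMn [r ^+ 2]expr2 mulrA rh; move: qK.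
by nra.
Qed.

(* The bump [(r - |x - x0|^2)^2] is a strict subsolution of [lap w + m w = 0]
   as soon as the quadratic [m P^2 - 4 (N + 2) P + 8 r] has no real root. *)
Lemma positive_supersolution_ge u L x0 (r m T : R) : continuous u ->
  (forall x, is_lap u x (L x)) -> 0 < r -> 0 < m ->
  (N%:R + 2) ^+ 2 < 2 * m * r ->
  (forall x, sq (x - x0) <= r -> 0 < u x) ->
  (forall x, sq (x - x0) <= r -> u x <= T -> L x <= - m * u x) ->
  T <= u x0.
Proof.
move=> cu uL r0 m0 nmr upos Lm; rewrite leNgt; apply/negP => uT.
pose S x := sq (x - x0).
have cS : continuous S := @sqB_continuous x0.
have S0 : S x0 = 0 by rewrite /S subrr /sq -(scale0r (0 : V)) dotZl mul0r.
pose A := [set x | sq (x - x0) <= r].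
have A0 : A x0 by rewrite /A /= -/(S x0) S0 ltW.
have cA : compact A by apply: ball_compact; exact: ltW.
have [um Aum umin] := min_on_compact cA A0 cu.
have um0 : 0 < u um := upos _ Aum.
(* Positivity of [u] is known only on [A]; truncating from below by its minimum there gives a
   denominator that is positive everywhere and agrees with [u] on [A]. *)
pose v x := Num.max (u um) (u x).
have vE x : A x -> v x = u x by move=> /umin; rewrite /v => /max_idPr.
have cv : continuous v.
  move=> x; apply: continuous_max; [exact: cst_continuous|exact: cu].
have v0 x : 0 < v x by rewrite /v lt_max um0.
have [|y Ay ymax] := @max_on_compact A (fun x => (r - S x) ^+ 2 / v x) x0 cA A0.
  have cP : continuous (fun x => r - S x).
    by apply: continuous_subf => //; exact: cst_continuous.
  apply: continuous_mulf; first exact: continuous_mulf.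
  by move=> x; apply: (@cvgV _ _ (nbhs x) _ v (v x)); [exact: lt0r_neq0|exact: cv].
(* The least [k] for which [k * u] dominates the bump on [A], with contact at [y]. *)
set k := (r - S y) ^+ 2 / v y in ymax.
have kP x : A x -> (r - S x) ^+ 2 <= k * u x.
  by move=> Ax; rewrite -(vE _ Ax) -ler_pdivrMr //; exact: ymax.
have rk : r ^+ 2 <= k * u x0 by have := kP _ A0; rewrite S0 subr0.
have u00 : 0 < u x0 := upos _ A0.
have r20 : 0 < r ^+ 2 by rewrite exprn_gt0.
have k0 : 0 < k by rewrite -(pmulr_lgt0 _ u00); lra.
set P := r - S y.
have kE : k * u y = P ^+ 2 by rewrite /k (vE _ Ay) divfK // gt_eqF // upos.
have uy0 : 0 < u y := upos _ Ay.
have P0 : 0 < P.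
  rewrite lt_neqAle subr_ge0 Ay andbT; apply/eqP => P0.
  by have := mulr_gt0 k0 uy0; rewrite kE -P0 expr0n /= ltxx.
have Pr : P <= r by rewrite /P; have : 0 <= S y := sq_ge0 _; lra.
(* At the contact point [k * u y = P ^+ 2 <= r ^+ 2 <= k * u x0 < k * T], so the differential
   inequality is available there. *)
have uyT : u y <= T.
  have : P ^+ 2 <= r ^+ 2 by rewrite ler_sqr ?nnegrE //; exact: ltW.
  by nra.
have psiD : \forall s \near S y, is_derive s (1 : R) (fun s => (r - s) ^+ 2) (- 2 * (r - s)).
  by near=> s; apply: trigger_derive; rewrite /GRing.scale /=; ring.
have psiDD : is_derive (S y) (1 : R) (fun s => - 2 * (r - s)) 2.
  by apply: trigger_derive; rewrite /GRing.scale /=; ring.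
have psiL := is_lap_radial psiD psiDD.
have near_min : \forall x \near y,
    k * u y - (r - sq (y - x0)) ^+ 2 <= k * u x - (r - sq (x - x0)) ^+ 2.
  have : \forall x \near y, S x < r.
    by apply: near_lt; [exact: cS|exact: cst_continuous|rewrite -subr_gt0].
  apply: filterS => x xr; rewrite -/(S y) -/P kE subrr subr_ge0.
  by apply: kP; exact: ltW.
have := is_lap_min_ge0 (is_lapB (is_lapZ k (uL y)) psiL) near_min.
have := Lm _ Ay uyT; rewrite -/(S y).
have -> : S y = r - P by rewrite /P; ring.
move: (L y) (u y) (N%:R : R) kE nmr => Ly uy n kE nmr Lu Ll.
have {Lu} : k * Ly <= - m * P ^+ 2 by rewrite -kE; nra.
move=> Lu; have : m * P ^+ 2 - 4 * (n + 2) * P + 8 * r <= 0 by lra.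
have := sqr_ge0 (m * P - 2 * (n + 2)).
by nra.
Unshelve. all: by end_near. Qed.

(** An exponential barrier in the shell between a small ball, where continuity keeps [w] above
    [eps], and the outer sphere, where the barrier vanishes; it stays below [w] in the shell. *)
Lemma strong_max_ball w L p (r M : R) : continuous w -> 0 <= M ->
  (forall x, sq (x - p) < r -> is_lap w x (L x)) ->
  (forall x, sq (x - p) <= r -> 0 <= w x) ->
  (forall x, sq (x - p) < r -> L x <= M * w x) ->
  0 < w p -> forall x, sq (x - p) < r -> 0 < w x.
Proof.
move=> cw M0 wL wpos LM wp x1 x1r.
set eps := w p / 2; have eps0 : 0 < eps by rewrite divr_gt0.
have [s0 s00 s0P] : exists2 s : R, 0 < s & forall x, sq (x - p) <= s -> eps < w x.
  apply: nbhs_sq; apply: near_lt; [exact: cst_continuous|exact: cw|].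
  by rewrite /eps; lra.
have [x1s|sx1] := lerP (sq (x1 - p)) s0; first by apply: lt_trans (s0P _ x1s).
pose S x := sq (x - p).
have cS : continuous S := @sqB_continuous p.
(* For [s >= s0] this gives [s * al > N%:R + M + 1], so the Laplacian
   [2 * al * (2 * s * al - N%:R) * E s] of the exponential exceeds [M * E s]. *)
pose al : R := (N%:R + M + 1) / s0 + 1.
have al1 : 1 <= al.
  by rewrite lerDr; apply: divr_ge0; [have := ler0n R N; lra|exact: ltW].
have als : s0 * al = N%:R + M + 1 + s0 by rewrite /al; field; rewrite gt_eqF.
pose E (s : R) := expR (- al * s).
have cE : continuous E.
  move=> s; apply: (continuous_comp (f := fun s => - al * s) (g := expR)).
    exact: mulrl_continuous.
  exact: continuous_expR.
pose A := [set x | s0 <= S x] `&` [set x | S x <= r].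
have cA : compact A.
  apply: (@subclosed_compact _ _ [set x | S x <= r]); last by move=> x [].
    apply: closedI.
      by apply: (@closed_le_fun V (cst s0) S) => //; exact: cst_continuous.
    by apply: (@closed_le_fun V S (cst r)) => //; exact: cst_continuous.
  by apply: ball_compact; apply: le_trans (ltW x1r); exact: sq_ge0.
have A1 : A x1 by split; exact: ltW.
pose F x := w x - eps * (E (S x) - E r).
have cF : continuous F.
  apply: continuous_subf => //; apply: continuous_mulf; first exact: cst_continuous.
  apply: continuous_subf; last exact: cst_continuous.
  by move=> x; apply: (continuous_comp (f := S) (g := E)); [exact: cS|exact: cE].
have [y [sy ry] ymin] := min_on_compact cA A1 cF.
have Er0 : 0 < E r := expR_gt0 _.
suff Fy : 0 <= F y.
  have Er1 : E r < E (S x1).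
    by rewrite ltr_expR !mulNr ltrN2 ltr_pM2l //; lra.
  have := le_trans Fy (ymin _ A1); have : 0 < eps * (E (S x1) - E r).
    by rewrite mulr_gt0 // subr_gt0.
  by rewrite /F; lra.
rewrite leNgt; apply/negP => Fy.
have E1 : E (S y) <= 1.
  rewrite -expR0 ler_expR mulNr oppr_le0 mulr_ge0 //; first lra.
  exact: sq_ge0.
have ys : s0 < S y.
  rewrite lt_neqAle sy andbT; apply/eqP => ys.
  by have := s0P y; rewrite -/(S y) -ys lexx => /(_ isT); move: Fy; rewrite /F; nra.
have yr : S y < r.
  rewrite lt_neqAle [S y <= r]ry andbT; apply/eqP => yr.
  by have := wpos y ry; move: Fy; rewrite /F yr subrr; lra.
have psiD : \forall s \near S y, is_derive s (1 : R) E (- al * E s).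
  by near=> s; apply: trigger_derive; rewrite /GRing.scale /= /E; ring.
have psiDD : is_derive (S y) (1 : R) (fun s => - al * E s) (al ^+ 2 * E (S y)).
  by apply: trigger_derive; rewrite /GRing.scale /= /E; ring.
have psiL := is_lap_radial psiD psiDD.
have near_min : \forall x \near y,
    w y - eps * E (sq (y - p)) <= w x - eps * E (sq (x - p)).
  have n1 : \forall x \near y, S x < r.
    by apply: near_lt; [exact: cS|exact: cst_continuous|].
  have n2 : \forall x \near y, s0 < S x.
    by apply: near_lt; [exact: cst_continuous|exact: cS|].
  near=> x; have : F y <= F x.
    by apply: ymin; split; apply: ltW; near: x.
  by rewrite /F -/(S x) -/(S y); lra.
have := is_lap_min_ge0 (is_lapB (wL y yr) (is_lapZ eps psiL)) near_min.
have := LM y yr; move: Fy; rewrite /F -/(S y).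
move: (N%:R : R) (ler0n R N) als => n n0 als.
have Ey : 0 < E (S y) := expR_gt0 _.
move: (L y) (w y) (E (S y)) (E r) Ey Er0 E1 => Ly wy e er e0 er0 e1 wye LM' Ll.
have : M * wy <= M * (eps * e) by rewrite ler_wpM2l //; nra.
move=> Mw; have : (2 * n * (- al * e) + 4 * S y * (al ^+ 2 * e)) <= M * e.
  by rewrite -(ler_pM2l eps0); lra.
have -> : 2 * n * (- al * e) + 4 * S y * (al ^+ 2 * e) = (2 * al * (2 * (S y * al) - n)) * e.
  by ring.
rewrite ler_pM2r //.
have : s0 * al <= S y * al by rewrite ler_wpM2r // ltW //; lra.
by rewrite als; nra.
Unshelve. all: by end_near. Qed.

End MaximumPrinciples.

(** * Moving planes *)

Section MovingPlanes.
Context {R : realType} {N : nat}.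
Notation V := 'rV[R]_N.
Implicit Types (x y p e : V).

(** The expression is the difference quotient of [t ^+ 3 - t], a function increasing beyond its
    critical point [a], which is [1 / sqrt 3]. *)
Lemma sum_sq_gt1 (a s t : R) : 0 < a -> 3 * a ^+ 2 = 1 -> a < s -> a < t ->
  0 < s ^+ 2 + s * t + t ^+ 2 - 1.
Proof.
rewrite -(subr_gt0 a s) -(subr_gt0 a t) => a0 a2 p0 q0.
have := mulr_gt0 p0 q0; have := mulr_gt0 a0 p0; have := mulr_gt0 a0 q0.
by have := sqr_ge0 (s - a); have := sqr_ge0 (t - a); nra.
Qed.

Lemma le_sqr_of_succ_le (r q : R) : `|r| + 1 <= q -> r <= q ^+ 2.
Proof. by have := ler_norm r; have := normr_ge0 r; nra. Qed.

Lemma mirror_dot e (l : R) x : sq e = 1 -> dot (mirror e l x) e = 2 * l - dot x e.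
Proof. by move=> e1; rewrite /mirror dotBl dotZl -/(sq e) e1; ring. Qed.

Lemma mirrorK e (l : R) x : sq e = 1 -> mirror e l (mirror e l x) = x.
Proof.
move=> e1; rewrite {1}/mirror mirror_dot // /mirror -addrA -opprD -scalerDl.
by rewrite [X in X *: _](_ : _ = 0) ?scale0r ?subr0 //; ring.
Qed.

Lemma mirror_fix e (l : R) x : dot x e = l -> mirror e l x = x.
Proof. by move=> xl; rewrite /mirror xl subrr mulr0 scale0r subr0. Qed.

Lemma dot_continuousl e : continuous (fun x => dot x e).
Proof. by apply: dot_continuous; [move=> x; exact: cvg_id|exact: cst_continuous]. Qed.

Lemma mirror_continuous (T : topologicalType) e (l : T -> R) (f : T -> V) :
  continuous l -> continuous f -> continuous (fun t => mirror e (l t) (f t)).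
Proof.
move=> cl cf.
have c : continuous (fun t => 2 * (dot (f t) e - l t)).
  apply: continuous_mulf; first exact: cst_continuous.
  apply: continuous_subf => //; apply: dot_continuous => //; exact: cst_continuous.
move=> t; apply: (@cvgB _ V _ (nbhs t) _ f (fun t => (2 * (dot (f t) e - l t)) *: e)).
  exact: cf.
by apply: cvgZr_tmp; exact: c.
Qed.

Lemma is_lap_strip e (s0 : R) y : sq e = 1 ->
  is_lap (fun x => 1 - (dot x e - s0) ^+ 2) y (- 2).
Proof.
move=> e1; exists (fun i => - 2 * e 0 i ^+ 2); last first.
  by rewrite -mulr_sumr (_ : \sum_i _ = 1) ?mulr1.
move=> i; set c := dot y e - s0; set b := e 0 i.
have E t : 1 - (dot (y + t *: delta_mx 0 i) e - s0) ^+ 2 = 1 - (c + t * b) ^+ 2.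
  by rewrite dotDl dotZl (dotC (delta_mx _ _)) dot_delta addrAC.
under eq_fun do rewrite E.
exists (fun t => - 2 * (c + t * b) * b).
  by near=> t; apply: trigger_derive; rewrite /GRing.scale /=; ring.
by apply: trigger_derive; rewrite /GRing.scale /=; ring.
Unshelve. all: by end_near. Qed.

(** Positivity spreads from [p] to [z] along a chain of balls centred on the segment; the segment
    keeps distance at least [d] from the plane, so balls of radius [d / 2] stay inside the
    half-space. *)
Lemma halfspace_strong_max (w L : V -> R) (M l : R) e p : sq e = 1 ->
  continuous w -> 0 <= M ->
  (forall x, is_lap w x (L x)) ->
  (forall x, dot x e < l -> 0 <= w x) ->
  (forall x, dot x e < l -> L x <= M * w x) ->
  dot p e < l -> 0 < w p -> forall z, dot z e < l -> 0 < w z.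
Proof.
move=> e1 cw M0 wL wpos LM pl wp z zl.
pose d := Num.min (l - dot p e) (l - dot z e).
have d0 : 0 < d by rewrite lt_min !subr_gt0 pl zl.
have dp : d <= l - dot p e by rewrite ge_min lexx.
have dz : d <= l - dot z e by rewrite ge_min lexx orbT.
pose r := (d / 2) ^+ 2.
have r0 : 0 < r by rewrite exprn_gt0 // divr_gt0.
have step q x : dot q e <= l - d -> 0 < w q -> sq (x - q) < r -> 0 < w x.
  move=> ql wq; have inH y : sq (y - q) <= r -> dot y e < l.
    move=> /(le_trans (dot_unit_le _ e1)); rewrite dotBl /r => h; nra.
  apply: (@strong_max_ball _ _ w L q r M) => // y yr; [exact/wpos/inH|].
  exact/LM/inH/ltW.
have sz := sq_ge0 (z - p).
(* The number of links: consecutive centres, [(z - p) / n] apart, must lie within [d / 2] of each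
   other. *)
have [n n0 nP] : exists2 n : nat, (0 < n)%N & sq (z - p) / n%:R ^+ 2 < r.
  exists (Num.bound (sq (z - p) / r)).+1 => //.
  have b0 : 0 <= sq (z - p) / r by rewrite divr_ge0 // ltW.
  have := archi_boundP b0; rewrite ltr_pdivrMr // => bP.
  rewrite ltr_pdivrMr ?exprn_gt0 //.
  have : (0 : R) <= (Num.bound (sq (z - p) / r))%:R by [].
  rewrite -natr1; move: bP; move: (_%:R : R) => b bP b1.
  by nra.
have n0' : 0 < n%:R :> R by rewrite ltr0n.
suff H k : (k <= n)%N -> 0 < w (p + (k%:R / n%:R) *: (z - p)).
  have := H n (leqnn n); rewrite divff ?gt_eqF // scale1r.
  by rewrite addrC subrK.
elim: k => [_|k IHk kn]; first by rewrite mul0r scale0r addr0.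
apply: step (IHk (ltnW kn)) _.
  rewrite dotDl dotZl dotBl.
  have k1 : k%:R / n%:R <= 1 :> R by rewrite ler_pdivrMr // mul1r ler_nat ltnW.
  have k0 : 0 <= k%:R / n%:R :> R by rewrite divr_ge0.
  by nra.
rewrite opprD addrACA subrr add0r -scalerBl -mulrBl -natr1 addrAC subrr add0r mul1r.
by rewrite sqZ exprVn mulrC.
Qed.

Variables (u : V -> R) (delta z a K : R).
Hypothesis cu : continuous u.
Hypothesis uK : forall x, `|u x| <= K.
Hypothesis uz : forall x, u x <= z.
Hypothesis a0 : 0 < a.
Hypothesis a2 : 3 * a ^+ 2 = 1.
Hypothesis az : a < z.
Hypothesis uinf : forall eps, 0 < eps -> exists r, forall x, r <= sq x -> z - eps <= u x.
Hypothesis ulap : forall x, is_lap u x (u x ^+ 3 - u x + delta).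
Hypothesis ulapR : forall e l x, sq e = 1 ->
  is_lap (fun y => u (mirror e l y)) x (u (mirror e l x) ^+ 3 - u (mirror e l x) + delta).

Section Direction.
Variable e : V.
Hypothesis e1 : sq e = 1.

(** Subtracting the equations of [u] and of its reflection gives [lap w = C * w], with [C] the
    difference quotient of [t ^+ 3 - t]. *)
Let w l x := u x - u (mirror e l x).
Let C l x := u x ^+ 2 + u x * u (mirror e l x) + u (mirror e l x) ^+ 2 - 1.

Let w_continuous l : continuous (w l).
Proof.
apply: continuous_subf => // x.
apply: (continuous_comp (f := mirror e l) (g := u)); last exact: cu.
by apply: (mirror_continuous (l := cst l) (f := id)); [exact: cst_continuous|move=> ?; exact: cvg_id].
Qed.

Let w_lap l x : is_lap (w l) x (C l x * w l x).
Proof.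
have := is_lapB (ulap x) (ulapR l x e1).
set L := (X in is_lap _ _ X -> _); suff -> : L = C l x * w l x by [].
by rewrite /L /C /w; ring.
Qed.

Let good l := forall x, dot x e < l -> 0 <= w l x.

(* [g = 1 - (x.e - s0)^2] is a strict supersolution in the strip
   [s0 < x.e <= s0 + 1/2], where [C >= -1] is all that is known of the
   zeroth order coefficient [C]; where [u > a], [C > 0] at negative minima. *)
Let narrow_strip l s0 : s0 < l -> l <= s0 + 1 / 2 ->
  (forall x, dot x e <= s0 -> u x <= a -> 0 <= w l x) -> good l.
Proof.
move=> sl ls wa x1 x1l; rewrite leNgt; apply/negP => wx1.
(* Clamping [dot x e - s0] to [[0, 1/2]] extends the strip function continuously: [g] is [1] below
   the strip and lies between [3/4] and [1] everywhere. *)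
pose m x := Num.min (Num.max 0 (dot x e - s0)) (1 / 2).
have m0 x : 0 <= m x by rewrite le_min le_max lexx /=; lra.
have m2 x : m x <= 1 / 2 by rewrite ge_min lexx orbT.
pose g x := 1 - m x * m x.
have g1 x : g x <= 1 by rewrite /g; have := m0 x; nra.
have g34 x : 3 / 4 <= g x by rewrite /g; have := m0 x; have := m2 x; nra.
have gpos x : 0 < g x by have := g34 x; lra.
have cm : continuous m.
  move=> x; apply: (@continuous_min _ _ (fun x => Num.max 0 (dot x e - s0)) (cst (1 / 2))).
    apply: (@continuous_max _ _ (cst 0) (fun x => dot x e - s0)).
      exact: cst_continuous.
    by apply: continuous_subf; [exact: dot_continuousl|exact: cst_continuous].
  exact: cst_continuous.
have cg : continuous g.
  by apply: continuous_subf; [exact: cst_continuous|exact: continuous_mulf].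
pose Q x := w l x / g x.
have cQ : continuous Q.
  apply: continuous_mulf => // x.
  by apply: (@cvgV _ _ (nbhs x) _ g (g x)); [exact: lt0r_neq0|exact: cg].
pose k1 := - Q x1.
have k10 : 0 < k1 by rewrite oppr_gt0 pmulr_llt0 // invr_gt0.
(* As [g >= 3 / 4] and the reflected value is at most [z], this tolerance forces
   [w l x >= - k1 * g x] far out, so the minimum of [Q] over a compact set controls the whole
   half-space. *)
have [r rP] := uinf (eps := k1 * (3 / 4)) ltac:(lra).
pose A := [set x | dot x e <= l] `&` [set x | sq x <= Num.max r (sq x1)].
have cA : compact A.
  apply: (@sq_bounded_compact _ _ _ (Num.max r (sq x1))); last by move=> x [].
  apply: closedI.
    by apply: (@closed_le_fun _ V _ (cst l)); [exact: dot_continuousl|exact: cst_continuous].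
  apply: (@closed_le_fun _ V _ (cst (Num.max r (sq x1)))); last exact: cst_continuous.
  by apply: sq_continuous => x; exact: cvg_id.
have A1 : A x1 by split=> /=; [exact: ltW|rewrite le_max lexx orbT].
have [y [/= yl yr] ymin] := min_on_compact cA A1 cQ.
pose k := - Q y.
have kk : k1 <= k by rewrite lerN2; exact: ymin.
have k0 : 0 < k by lra.
have wk x : dot x e <= l -> 0 <= w l x + k * g x.
  move=> xl; have [xr|rx] := lerP (sq x) (Num.max r (sq x1)).
    have := ymin x (conj xl xr); rewrite {2}/Q ler_pdivlMr //.
    by rewrite /k; lra.
  have : r <= sq x by apply: le_trans (ltW rx); rewrite le_max lexx.
  move=> /rP; have := uz (mirror e l x); have := g34 x; rewrite /w => h1 h2 h3.
  have : k1 * (3 / 4) <= k * g x by nra.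
  by lra.
have wy : w l y = - k * g y by rewrite /k opprK divfK // gt_eqF.
have wy0 : w l y < 0 by rewrite wy mulNr oppr_lt0 mulr_gt0.
have {}yl : dot y e < l.
  rewrite lt_neqAle yl andbT; apply/eqP => yl'.
  by move: wy0; rewrite /w mirror_fix // subrr ltxx.
have near_l : \forall x \near y, dot x e < l.
  by apply: near_lt => //; [exact: dot_continuousl|exact: cst_continuous].
have C1 : -1 <= C l y by rewrite /C; nra.
(* Below the strip [g y = 1] is maximal, so [w l] itself has a local minimum at [y]; there
   [a < u y < u (mirror e l y)], hence [C > 0] and [C * w < 0], a contradiction. *)
have [ys|sy] := lerP (dot y e) s0.
  have gy : g y = 1.
    rewrite /g /m; have -> : Num.max 0 (dot y e - s0) = 0.
      by apply/max_idPl; rewrite subr_le0.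
    by rewrite (_ : Num.min _ _ = 0) ?mulr0 ?subr0 //; apply/min_idPl; lra.
  have := is_lap_min_ge0 (w_lap l y).
  have nm : \forall x \near y, w l y <= w l x.
    apply: filterS near_l => x xl; have := wk x (ltW xl).
    by rewrite wy gy; have := g1 x; nra.
  move=> /(_ nm).
  have [ua|ua] := lerP (u y) a; first by have := wa y ys ua; lra.
  have : 0 < C l y.
    have ua' : a < u (mirror e l y) by move: wy0; rewrite /w; lra.
    exact: sum_sq_gt1 ua'.
  by move=> C0; rewrite leNgt pmulr_rlt0 // wy0.
have near_s : \forall x \near y, s0 < dot x e.
  by apply: near_lt => //; [exact: cst_continuous|exact: dot_continuousl].
have gE x : s0 < dot x e -> dot x e < l -> g x = 1 - (dot x e - s0) ^+ 2.
  move=> sx xl; rewrite /g /m.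
  have -> : Num.max 0 (dot x e - s0) = dot x e - s0 by apply/max_idPr; lra.
  by rewrite (_ : Num.min _ _ = dot x e - s0) //; apply/min_idPl; lra.
(* Inside the strip [w l + k * g] has minimum [0] at [y], but its Laplacian is
   [- k * (C * g + 2) < 0], because [C >= -1] and [g <= 1]. *)
have := is_lap_min_ge0 (is_lapD (w_lap l y) (is_lapZ k (is_lap_strip s0 y e1))).
have nm : \forall x \near y, w l y + k * (1 - (dot y e - s0) ^+ 2) <=
    w l x + k * (1 - (dot x e - s0) ^+ 2).
  near=> x; rewrite -(gE y) // -(gE x); [|by near: x|by near: x].
  have -> : w l y + k * g y = 0 by rewrite wy; ring.
  by apply: wk; apply: ltW; near: x.
move=> /(_ nm); rewrite wy; have := g1 y; have := gpos y; nra.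
Unshelve. all: by end_near. Qed.

(** For [l] very negative the half-space lies where [u > a], so the hypothesis of [narrow_strip]
    holds vacuously. *)
Let good_start : exists l0, forall l, l <= l0 -> good l.
Proof.
have [|r rP] := uinf (eps := (z - a) / 2); first by rewrite divr_gt0 // subr_gt0.
exists (- (`|r| + 1)) => l ll.
apply: (@narrow_strip l (l - 1 / 2)) => [||x xl ua]; [lra|lra|].
have rx : r <= sq x.
  apply: le_trans (dot_unit_le x e1); rewrite -sqrrN; apply: le_sqr_of_succ_le; lra.
by have := rP x; move=> /(_ rx); have := az; lra.
Qed.

(** A point where symmetry fails, or its mirror image, gives a point of the half-space with [w > 0];
    the bound [C <= 3 * K ^+ 2] then allows the strong maximum principle. *)
Let not_sym_pos l : good l -> ~ (forall x, u (mirror e l x) = u x) ->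
  forall x, dot x e < l -> 0 < w l x.
Proof.
move=> gl /existsNP[x0 x0N].
have [p pl wp] : exists2 p, dot p e < l & 0 < w l p.
  have [x0l|lx0|/mirror_fix x0l] := ltgtP (dot x0 e) l; last by case: x0N; rewrite x0l.
    exists x0 => //; rewrite lt_neqAle gl // andbT eq_sym subr_eq0 eq_sym.
    exact/eqP.
  have rl : dot (mirror e l x0) e < l by rewrite mirror_dot //; lra.
  exists (mirror e l x0) => //; rewrite lt_neqAle gl // andbT eq_sym /w mirrorK // subr_eq0.
  exact/eqP.
apply: (@halfspace_strong_max (w l) (fun x => C l x * w l x) (3 * K ^+ 2) l e p) => //.
- by rewrite mulr_ge0 ?sqr_ge0.
- move=> x xl; apply: ler_wpM2r; first exact: gl.
  have := uK x; have := uK (mirror e l x); rewrite !ler_norml /C.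
  by move: (u x) (u (mirror e l x)) => s t; nra.
Qed.

(** Away from the plane, [u <= a] can occur only in a compact set; there [w l > 0] persists for
    nearby planes, and [narrow_strip] handles the rest. *)
Let good_open l : good l -> ~ (forall x, u (mirror e l x) = u x) ->
  exists2 d, 0 < d & forall m, l <= m <= l + d -> good m.
Proof.
move=> gl nsym; have wpos := not_sym_pos gl nsym.
have [|r rP] := uinf (eps := (z - a) / 2); first by rewrite divr_gt0 // subr_gt0.
(* A quarter on each side: for [m <= l + 1 / 4] the strip from [s0] to [m] still has width at most
   [1 / 2]. *)
pose s0 := l - 1 / 4.
pose A := [set x | dot x e <= s0] `&` [set x | sq x <= r].
have cA : compact A.
  apply: (@sq_bounded_compact _ _ _ r); last by move=> x [].
  apply: closedI.
    by apply: (@closed_le_fun _ V _ (cst s0)); [exact: dot_continuousl|exact: cst_continuous].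
  apply: (@closed_le_fun _ V _ (cst r)); last exact: cst_continuous.
  by apply: sq_continuous => x; exact: cvg_id.
have /(_ R (nbhs l) (fun m x => u (mirror e m x) < u x) _) := iffLR (compact_near_coveringP A) cA.
have nA x : A x -> \forall x' \near x & m \near l, u (mirror e m x') < u x'.
  move=> [/= xs _].
  have := @near_lt R (V * R)%type (fun t => u (mirror e t.2 t.1)) (fun t => u t.1) (x, l).
  apply.
  - move=> t; apply: (continuous_comp (f := fun t : V * R => mirror e t.2 t.1) (g := u)); last exact: cu.
    apply: mirror_continuous => t'; [exact: cvg_snd|exact: cvg_fst].
  - move=> t; apply: (continuous_comp (f := fst) (g := u)); [exact: cvg_fst|exact: cu].
  - by rewrite -subr_gt0; apply: wpos; rewrite /= /s0 in xs *; lra.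
move=> /(_ nA)/nbhs_ballP[d /= d0 dP].
exists (Num.min (d / 2) (1 / 4)); first by rewrite lt_min; apply/andP; split; lra.
move=> m /andP[lm]; rewrite -lerBlDl le_min => /andP[md m4].
apply: (@narrow_strip m s0) => [||x xs ua]; rewrite /s0; [lra|lra|].
rewrite subr_ge0; apply/ltW/(dP m); last first.
  split=> //=; rewrite leNgt; apply/negP => /ltW/rP; have := az; lra.
by rewrite -ball_normE /= distrC ger0_norm; lra.
Qed.

Lemma moving_planes : exists l, forall x, u (mirror e l x) = u x.
Proof.
apply: contrapT => /forallNP nsym.
pose A := [set l | forall m, m <= l -> good m].
have [l0 A0] : exists l0, A l0 by have [l0 ?] := good_start; exists l0.
have [|nub] := pselect (has_ubound A); last first.
  (* If planes never stop, reflecting a point in planes ever farther away gives [u x >= z] in the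
     limit; then [u] is constant and every plane is one of symmetry. *)
  case: (nsym 0) => x0; suff uE x : u x = z by rewrite !uE.
  apply/eqP; rewrite eq_le uz leNgt; apply/negP => ux.
  have [|r rP] := uinf (eps := (z - u x) / 2); first by rewrite divr_gt0 // subr_gt0.
  pose b := `|r| + 1 + `|dot x e|.
  have [l Al bl] : exists2 l, A l & b < l.
    apply: contrapT => H; apply: nub; exists b => l Al; rewrite leNgt; apply/negP => bl.
    by apply: H; exists l.
  have dx := ler_norm (dot x e); have rn := ler_norm r; have rn0 := normr_ge0 r.
  have xl : dot x e < l by move: bl; rewrite /b; lra.
  have := Al l (lexx l) x xl; rewrite /w.
  have := rP (mirror e l x); have := dot_unit_le (mirror e l x) e1.
  rewrite mirror_dot // => h1 h2 h3; have : r <= sq (mirror e l x).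
    apply: le_trans h1; apply: le_sqr_of_succ_le.
    by move: bl; rewrite /b; have := normr_ge0 (dot x e); lra.
  by move=> /h2; lra.
move=> ub; have sA : has_sup A by split=> //; exists l0.
set l := sup A.
have glt m : m < l -> good m.
  move=> ml; have lm0 : 0 < l - m by rewrite subr_gt0.
  have [b Ab mb] := sup_adherent lm0 sA.
  by apply: Ab; move: mb; rewrite -/l; lra.
have gl : good l.
  move=> x xl; rewrite leNgt; apply/negP => wx.
  have : \forall m \near l, w m x < 0.
    apply: (@near_lt R R (fun m => w m x) (cst 0)) => //; last exact: cst_continuous.
    apply: continuous_subf; first exact: cst_continuous.
    move=> m; apply: (continuous_comp (f := fun m : R => mirror e m x) (g := u)); last exact: cu.
    by apply: mirror_continuous; [move=> ?; exact: cvg_id|exact: cst_continuous].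
  move=> /nbhs_ballP[d /= d0 dP].
  (* A plane before [l], close enough to keep [w m x < 0] and beyond [dot x e], so that [x] is still
     in its half-space. *)
  pose m := Num.max (l - d / 2) ((l + dot x e) / 2).
  have ml : m < l by rewrite gt_max; apply/andP; split; lra.
  have dm : l - d / 2 <= m by rewrite le_max lexx.
  have xm : (l + dot x e) / 2 <= m by rewrite le_max lexx orbT.
  have := glt m ml x; rewrite leNgt dP => [|].
    by move=> /(_ ltac:(lra)).
  by rewrite -ball_normE /= ger0_norm; lra.
have [d d0 dP] := good_open gl (nsym l).
suff : A (l + d) by move=> /(ub_le_sup ub); rewrite -/l; lra.
move=> m md; have [ml|lm] := ltrP m l; first exact: glt.
by apply: dP; rewrite lm.
Qed.

End Direction.
End MovingPlanes.

(** * Radial symmetry and the energy of the radial profile *)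

Section Radial.
Context {R : realType} {N : nat}.
Notation V := 'rV[R]_N.
Implicit Types (x y e : V) (u : V -> R).

(** The coordinate reflections act on separate coordinates, and their composite is the point
    reflection in [\row_i l i]. *)
Lemma reflections_even u (l : 'I_N -> R) :
  (forall i x, u (mirror (delta_mx 0 i) (l i) x) = u x) ->
  forall x, u (2 *: (\row_i l i) - x) = u x.
Proof.
move=> ul x.
pose T r := foldr (fun i y => mirror (delta_mx 0 i) (l i) y) x r.
have uT r : u (T r) = u x by elim: r => //= i r IHr; rewrite ul.
rewrite -(uT (enum 'I_N)); congr u; apply/rowP => j.
have TE r : uniq r -> T r 0 j = if j \in r then 2 * l j - x 0 j else x 0 j.
  elim: r => //= i r IHr /andP[ir /IHr IH].
  rewrite /mirror !mxE dot_delta /= in_cons; have [ji|ji] := eqVneq j i.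
    by rewrite -ji in ir *; rewrite /= mulr1 IH (negPf ir); ring.
  by rewrite mulr0 subr0 IH.
by rewrite TE ?enum_uniq // mem_enum !mxE.
Qed.

(** Applying plane and point reflection alternately, twice each, is a translation by a multiple of
    [4 * (l - c)] along [e]; if the plane misses [x0], then [u] is periodic and equals its limit. *)
Lemma symmetric_plane_through_center u (z : R) x0 e (l : R) : sq e = 1 ->
  (forall x, u (2 *: x0 - x) = u x) ->
  (forall x, u (mirror e l x) = u x) ->
  (forall eps, 0 < eps -> exists r, forall x, r <= sq x -> `|u x - z| <= eps) ->
  l = dot x0 e \/ forall x, u x = z.
Proof.
move=> e1 ue ul ulim; have [->|lc] := eqVneq l (dot x0 e); [by left|right=> x].
set c := dot x0 e in lc.
have period y : u (y - (4 * (l - c)) *: e) = u y.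
  rewrite -[RHS]ul -[RHS]ue -[RHS]ul -[RHS]ue; congr u.
  set d := dot y e.
  have E1 : 2 *: x0 - mirror e l y = 2 *: x0 - y + (2 * (d - l)) *: e.
    by rewrite /mirror -/d opprB addrA addrAC.
  have dE : dot (2 *: x0 - mirror e l y) e = 2 * c + d - 2 * l.
    by rewrite E1 dotDl dotBl !dotZl -/(sq e) e1 -/d -/c; ring.
  rewrite [mirror e l (2 *: x0 - _)]/mirror dE /mirror -/d.
  by apply/rowP => j; rewrite !mxE; ring.
have periodn n : u (x - (n%:R * (4 * (l - c))) *: e) = u x.
  elim: n => [|n IHn]; first by rewrite mul0r scale0r subr0.
  by rewrite -natr1 mulrDl mul1r scalerDl opprD addrA period.
apply/eqP; rewrite -subr_eq0 -normr_le0; apply/ler_addgt0Pr => eps eps0; rewrite add0r.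
have [r rP] := ulim _ eps0.
pose t := 4 * `|l - c|.
have t0 : 0 < t by rewrite mulr_gt0 // normr_gt0 subr_eq0.
have bN : 0 <= (`|r| + 1 + `|dot x e|) / t by rewrite divr_ge0 ?addr_ge0 // ltW.
have := archi_boundP bN; set n := Num.bound _; rewrite ltr_pdivrMr // => nt.
rewrite -(periodn n); apply: rP; apply: le_trans (dot_unit_le _ e1).
rewrite dotBl dotZl -/(sq e) e1 mulr1 -real_normK ?num_real //.
apply: le_sqr_of_succ_le.
have := ler_dist_dist (n%:R * (4 * (l - c))) (dot x e).
rewrite distrC normrM normrM !(ger0_norm (ler0n _ _)) -/t => h.
have := ler_norm (n%:R * t - `|dot x e|); lra.
Qed.

(** For distinct [x] and [y] equidistant from [x0], the symmetry plane orthogonal to [x - y] passes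
    through [x0], so it is their perpendicular bisector and exchanges them. *)
Lemma reflections_radial u (z : R) :
  (forall e, sq e = 1 -> exists l, forall x, u (mirror e l x) = u x) ->
  (forall eps, 0 < eps -> exists r, forall x, r <= sq x -> `|u x - z| <= eps) ->
  exists x0, forall x y, sq (x - x0) = sq (y - x0) -> u x = u y.
Proof.
move=> ul ulim.
have [l lP] := choice (fun i => ul (delta_mx 0 i) (sq_delta i)).
exists (\row_i l i) => x y; set x0 := \row_i l i => xy.
have [->//|xNy] := eqVneq x y.
have n0 : 0 < sq (x - y) by rewrite sq_gt0 // subr_eq0.
set n := sq (x - y) in n0.
have sn0 : Num.sqrt n != 0 by rewrite gt_eqF // sqrtr_gt0.
have sn2 : Num.sqrt n ^+ 2 = n by rewrite sqr_sqrtr // ltW.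
pose e := (Num.sqrt n)^-1 *: (x - y).
have e1 : sq e = 1 by rewrite /e sqZ exprVn sn2 -/n mulVf // gt_eqF.
have [m mP] := ul e e1.
have [mE|uz] := symmetric_plane_through_center e1 (reflections_even lP) mP ulim; last by rewrite !uz.
have d2 : 2 * dot (x - x0) (x - y) = n.
  rewrite /n; have -> : x - y = (x - x0) - (y - x0) by rewrite opprB addrA subrK.
  by rewrite sqB dotBr -/(sq _) -xy; ring.
rewrite -(mP x); congr u; rewrite /mirror mE -dotBl /e dotZr scalerA.
set s := Num.sqrt n in sn0 sn2 *; set D := dot _ _ in d2 *.
have -> : 2 * (s^-1 * D) / s = (2 * D) / s ^+ 2 by field.
by rewrite d2 sn2 divff ?gt_eqF // scale1r opprB addrC subrK.
Qed.

Lemma radial_profile u x0 i0 : (forall x y, sq (x - x0) = sq (y - x0) -> u x = u y) ->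
  forall x, u x = u (x0 + enorm (x - x0) *: delta_mx 0 i0).
Proof.
move=> urad x; apply: urad.
rewrite [X in _ = sq X](_ : _ = enorm (x - x0) *: delta_mx 0 i0); last first.
  by rewrite addrAC subrr add0r.
by rewrite sqZ sq_delta mulr1 enorm_sqE sqr_sqrtr // sq_ge0.
Qed.

Lemma sum_ord_other (h : 'I_N -> R) i0 (c : R) :
  (forall i, i != i0 -> h i = c) -> \sum_i h i = h i0 + c *+ N.-1.
Proof.
move=> hc; rewrite (bigD1 i0) //= (eq_bigr (fun=> c)) // sumr_const.
by rewrite cardC1 card_ord.
Qed.

(** For [i != i0], the point [y + t *: ei] is at distance [h t = sqrt (r ^+ 2 + t ^+ 2)] from [x0],
    so the derivative along [ei] is [t * (phi1 (h t) / h t)], whose own derivative at [0] is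
    [phi1 r / r]. *)
Lemma radial_laplacian u x0 (i0 : 'I_N) : C2 u ->
  (forall x y, sq (x - x0) = sq (y - x0) -> u x = u y) ->
  forall r : R, 0 < r ->
  let e := delta_mx 0 i0 in
  laplacian u (x0 + r *: e) =
    hess u (x0 + r *: e) e e + ('D_e u (x0 + r *: e) / r) *+ N.-1.
Proof.
move=> uC urad r r0 e.
pose phi s := u (x0 + s *: e).
pose phi1 s := 'D_e u (x0 + s *: e).
have phiD (s : R) : is_derive s (1 : R) phi (phi1 s).
  by apply: is_derive_line; have [[]] := uC e.
have phi1D (s : R) : is_derive s (1 : R) phi1 (hess u (x0 + s *: e) e e).
  by apply: is_derive_line; have [_ /(_ e)[]] := uC e.
apply: (sum_ord_other (h := fun i => hess u (x0 + r *: e) (delta_mx 0 i) (delta_mx 0 i))).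
move=> i ii0; set y := x0 + r *: e; set ei := delta_mx 0 i.
pose h (t : R) := Num.sqrt (r ^+ 2 + t ^+ 2).
have q0 t : 0 < r ^+ 2 + t ^+ 2 by rewrite ltr_wpDr ?sqr_ge0 // exprn_gt0.
have h0 t : 0 < h t by rewrite sqrtr_gt0.
have hr : h 0 = r by rewrite /h expr0n addr0 sqrtr_sqr gtr0_norm.
have hD (t : R) : is_derive t (1 : R) h (t / h t).
  have D : is_derive t (1 : R) (fun t => r ^+ 2 + t ^+ 2) (2 * t).
    by apply: trigger_derive; rewrite /GRing.scale /=; ring.
  have D2 := @is_derive1_comp _ Num.sqrt (fun t => r ^+ 2 + t ^+ 2) t _ _
    (is_derive1_sqrt (q0 t)) D.
  apply: (is_derive_eq (f := h) D2).
  by rewrite -/(h t); field; rewrite gt_eqF.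
have uh t : u (y + t *: ei) = phi (h t).
  apply: urad.
  have -> : y + t *: ei - x0 = r *: e + t *: ei by rewrite /y addrAC (addrAC x0) subrr add0r.
  have -> : x0 + h t *: e - x0 = h t *: e by rewrite addrAC subrr add0r.
  have ortho : dot e ei = 0 by rewrite dot_delta mxE (negPf ii0) andbF.
  by rewrite sqD !sqZ !sq_delta sqr_sqrtr ?(ltW (q0 t)) // dotZl dotZr ortho; ring.
have Du t : 'D_ei u (y + t *: ei) = t * (phi1 (h t) * (h t)^-1).
  have D1 : is_derive t (1 : R) (fun s : R => u (y + s *: ei)) ('D_ei u (y + t *: ei)).
    by apply: is_derive_line; have [[]] := uC ei.
  have D2 := @is_derive1_comp _ phi h t _ _ (phiD (h t)) (hD t).
  have E : (fun s : R => u (y + s *: ei)) = phi \o h by apply/funext.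
  rewrite E in D1; have [_ <-] := D1; have [_ ->] := D2.
  by rewrite mulrCA mulrA.
have D1 : is_derive (0 : R) (1 : R) (fun t : R => 'D_ei u (y + t *: ei)) (hess u y ei ei).
  have := is_derive_line (u := 'D_ei u) (x := y) (v := ei) (t := 0).
  by rewrite scale0r addr0; apply; have [_ /(_ ei)[]] := uC ei.
have E : (fun t : R => 'D_ei u (y + t *: ei)) = (fun t => t * (phi1 (h t) * (h t)^-1)).
  by apply/funext.
rewrite E in D1; have [_ <-] := D1.
have hN0 : h 0 != 0 by rewrite gt_eqF.
have D3 := @is_deriveM _ _ (phi1 \o h) (fun t => (h t)^-1) 0 1 _ _
  (is_derive1_comp (phi1D (h 0)) (hD 0)) (@is_deriveV _ h 0 _ _ hN0 (hD 0)).
have [_ ->] := @is_deriveM _ _ id _ 0 1 _ _ (is_derive_id (0 : R) (1 : R)) D3.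
transitivity (phi1 (h 0) * (h 0)^-1); last by rewrite hr.
by rewrite scale0r add0r [LHS]mulr1.
Qed.

End Radial.

Section Energy.
Context {R : realType}.
Variables (phi phi1 phi2 : R -> R) (delta z K k : R).
Hypothesis phiD : forall r : R, is_derive r (1 : R) phi (phi1 r).
Hypothesis phi1D : forall r : R, is_derive r (1 : R) phi1 (phi2 r).
Hypothesis phi10 : phi1 0 = 0.
Hypothesis k0 : 0 < k.
Hypothesis ode : forall r : R, 0 < r ->
  phi2 r + k * (phi1 r / r) = phi r ^+ 3 - phi r + delta.
Hypothesis zE : delta = z - z ^+ 3.
Hypothesis z1 : 1 <= z.
Hypothesis phiK : forall r, `|phi r| <= K.
Hypothesis phi_lim : forall eps : R, 0 < eps ->
  exists q0, forall q : R, q0 <= q -> `|phi q - z| <= eps.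

Let F t := t ^+ 2 / 2 - t ^+ 4 / 4 - delta * t.
Let E r := phi1 r ^+ 2 / 2 + F (phi r).

(** Since [z] is a zero of the nonlinearity, [(t - z) ^+ 2] factors out; the cofactor is nonnegative
    when [z >= 1]. *)
Let F_gap t : F z - F t = (t - z) ^+ 2 * ((t + z) ^+ 2 + 2 * z ^+ 2 - 2) / 4.
Proof. by rewrite /F zE; field. Qed.

Let F_max t : F t <= F z.
Proof.
rewrite -subr_ge0 F_gap divr_ge0 // mulr_ge0 ?sqr_ge0 //.
by have := sqr_ge0 (t + z); have := z1; nra.
Qed.

Let E_derive (r : R) : 0 < r -> is_derive r (1 : R) E (- (k * phi1 r ^+ 2 / r)).
Proof.
move=> r0.
have D1 : is_derive r (1 : R) (fun t => phi1 t ^+ 2) (2 * phi1 r * phi2 r).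
  by apply: trigger_derive; rewrite /GRing.scale /=; ring.
have FD : is_derive (phi r) (1 : R) F (phi r - phi r ^+ 3 - delta).
  by apply: trigger_derive; rewrite /GRing.scale /=; field.
have D2 := is_derive1_comp FD (phiD r).
have D3 := is_deriveD (@is_deriveZ _ _ _ _ (2^-1) _ _ _ D1) D2.
have -> : E = 2^-1 \*: (fun t => phi1 t ^+ 2) + (F \o phi).
  apply/funext => t; transitivity (2^-1 * phi1 t ^+ 2 + F (phi t)) => //.
  by rewrite mulrC.
apply: (is_derive_eq D3); rewrite /GRing.scale /=.
have -> : phi r - phi r ^+ 3 - delta = - (phi2 r + k * (phi1 r / r)).
  by rewrite ode //; ring.
by field; rewrite gt_eqF.
Qed.

Let continuous_of_derive (f f1 : R -> R) : (forall r : R, is_derive r (1 : R) f (f1 r)) ->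
  continuous f.
Proof. by move=> fD r; apply/differentiable_continuous/derivable1_diffP. Qed.

Let E_continuous : continuous E.
Proof.
have c1 := continuous_of_derive phi1D; have c := continuous_of_derive phiD.
have FD (t : R) : is_derive t (1 : R) F (t - t ^+ 3 - delta).
  by apply: trigger_derive; rewrite /GRing.scale /=; field.
move=> r; apply: (@cvgD _ _ _ (nbhs r) _ (fun r => phi1 r ^+ 2 / 2) (F \o phi)).
  apply: (continuous_comp (f := phi1) (g := fun t => t ^+ 2 / 2)); first exact: c1.
  by apply: cvgM; [exact: exprn_continuous|exact: cvg_cst].
apply: continuous_comp; [exact: c|exact: (continuous_of_derive FD)].
Qed.

Let E_noninc (p q : R) : 0 <= p -> p <= q -> E q <= E p.
Proof.
move=> p0; rewrite le_eqVlt => /predU1P[->//|pq].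
have [||c] := @MVT R E (fun r => - (k * phi1 r ^+ 2 / r)) p q pq.
- by move=> x; rewrite in_itv /= => /andP[px _]; apply: E_derive; lra.
- exact: continuous_subspaceT.
rewrite in_itv /= => /andP[pc cq] EE.
have : 0 <= k * phi1 c ^+ 2 / c.
  by apply: divr_ge0; [apply: mulr_ge0; [exact: ltW|exact: sqr_ge0]|lra].
by nra.
Qed.

Let E_ge (p : R) : 0 <= p -> F z <= E p.
Proof.
move=> p0; rewrite leNgt; apply/negP => EF.
set eta := F z - E p; have eta0 : 0 < eta by rewrite subr_gt0.
(* [M] bounds the cofactor in [F_gap] along the profile; once [|phi q - z| <= min 1 (eta / M)], the
   gap is at most [eta / 4], while monotonicity of [E] makes it at least [eta]. *)
pose M := (K + z) ^+ 2 + 2 * z ^+ 2.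
have M0 : 0 < M by rewrite /M; have := z1; have := sqr_ge0 (K + z); nra.
have m0 : 0 < Num.min 1 (eta / M) by rewrite lt_min ltr01 divr_gt0.
have [q0 qP] := phi_lim m0.
pose q := Num.max p q0.
have pq : p <= q by rewrite le_max lexx.
have := qP q; rewrite le_max lexx orbT => /(_ isT); rewrite le_min ler_pdivlMr // => /andP[d1 dM].
have : F (phi q) <= E q by rewrite /E lerDr divr_ge0 ?sqr_ge0.
have := E_noninc p0 pq => Eqp Fq.
have : eta <= F z - F (phi q) by rewrite /eta; lra.
rewrite F_gap; have := phiK q; have := phiK q; rewrite {1}ler_norml => /andP[k1 k2] k3.
set d := phi q - z in d1 dM *.
have dd : d ^+ 2 <= `|d|.
  by rewrite -real_normK ?num_real // expr2 ler_piMl.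
have : (phi q + z) ^+ 2 <= (K + z) ^+ 2.
  have := z1; nra.
move=> h1; set B := (phi q + z) ^+ 2 + 2 * z ^+ 2 - 2.
have BM : B <= M by rewrite /B /M; lra.
have B0 : 0 <= B by rewrite /B; have := sqr_ge0 (phi q + z); have := z1; nra.
have : d ^+ 2 * B <= `|d| * M by apply: ler_pM => //; exact: sqr_ge0.
by lra.
Qed.

(** The energy starts at most at [F z], because [phi1 0 = 0], and never drops below [F z]; being
    constant, it has zero dissipation. *)
Let phi1_eq0 (r : R) : 0 < r -> phi1 r = 0.
Proof.
move=> r0.
have EFz p : 0 <= p -> E p = F z.
  move=> p0; apply/eqP; rewrite eq_le E_ge // andbT.
  apply: le_trans (E_noninc (lexx 0) p0) _.
  by rewrite /E phi10 expr0n /= mul0r add0r F_max.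
have near_cst : \forall t \near r, cst (F z) t = E t.
  by apply: filterS (lt_nbhsr r0) => t t0; rewrite EFz // ltW.
have [_ E0] := near_eq_is_derive near_cst (is_derive_cst (F z) r (1 : R)).
have [_] := E_derive r0; rewrite E0 => /esym/eqP; rewrite oppr_eq0.
rewrite !mulf_eq0 invr_eq0 (gt_eqF k0) (gt_eqF r0) orbF orbb /=.
by move=> /eqP.
Qed.

Lemma energy_rigidity (r : R) : 0 <= r -> phi r = z.
Proof.
move=> r0.
have phi_cst q : r <= q -> phi q = phi r.
  rewrite le_eqVlt => /predU1P[->//|rq].
  have [|c] := @MVT R phi phi1 r q rq (fun x _ => phiD x).
    by apply: continuous_subspaceT; exact: continuous_of_derive phiD.
  rewrite in_itv /= => /andP[rc cq]; rewrite phi1_eq0 ?mul0r; last lra.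
  by move/eqP; rewrite subr_eq0 => /eqP.
apply/eqP; rewrite -subr_eq0 -normr_le0; apply/ler_addgt0Pr => eps eps0; rewrite add0r.
have [q0 qP] := phi_lim eps0.
rewrite -(phi_cst (Num.max r q0)); first by apply: qP; rewrite le_max lexx orbT.
by rewrite le_max lexx.
Qed.

End Energy.

(** * Solutions of the equation *)

Section Roots.
Context {R : realType}.
Variable delta : R.
Hypothesis delta_range : - delta_bound R < delta < delta_bound R.

Let s : R := (Num.sqrt 3)^-1.

Lemma inv_sqrt3_sq : 3 * s ^+ 2 = 1.
Proof. by rewrite exprVn sqr_sqrtr // mulfV. Qed.

Lemma inv_sqrt3_gt0 : 0 < s.
Proof. by rewrite invr_gt0 sqrtr_gt0. Qed.

Lemma norm_delta_le1 : `|delta| <= 1.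
Proof.
have := delta_range; rewrite /delta_bound invfM mulrA -/s => /andP[d1 d2].
have s2 := inv_sqrt3_sq; have s0 := inv_sqrt3_gt0.
have s1 : s < 1 by nra.
rewrite ler_norml; lra.
Qed.

Lemma z3_gt : s < z3 delta.
Proof. by have [] := f_delta_roots delta_range. Qed.

Lemma delta_z3 : delta = z3 delta - z3 delta ^+ 3.
Proof.
have [_ _ _ /(_ (z3 delta))[_ H]] := f_delta_roots delta_range.
by have := H (Or33 _ _ erefl); rewrite /f_delta; lra.
Qed.

(** The cubic has no quadratic term, so its third root is [- (z2 delta + z3 delta)]. *)
Lemma f_delta_factor t : t ^+ 3 - t + delta =
  (t - z3 delta) * (t - z2 delta) * (t + z2 delta + z3 delta).
Proof.
have [_ /andP[_ q1] r1 rt] := f_delta_roots delta_range.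
have [_ /(_ (Or32 _ _ erefl))] := rt (z2 delta).
have := delta_z3; rewrite /f_delta; move: (z2 delta) (z3 delta) q1 r1 => q z q1 r1 dz dq.
have E : q ^+ 2 + q * z + z ^+ 2 = 1.
  apply: (mulfI (x := q - z)); first by apply/eqP; lra.
  by lra.
rewrite dz; transitivity ((t - z) * (t - q) * (t + q + z) +
  (t - z) * (q ^+ 2 + q * z + z ^+ 2 - 1)); first ring.
by rewrite E subrr mulr0 addr0.
Qed.

(** As the roots sum to zero, this quantity is [z2 - z1]; it bounds the last factor of
    [f_delta_factor] from below for [t > z2]. *)
Lemma z2_z3_gt0 : 0 < 2 * z2 delta + z3 delta.
Proof.
have [_ /andP[q0 q1] r1 rt] := f_delta_roots delta_range.
have [_ /(_ (Or32 _ _ erefl))] := rt (z2 delta).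
have := delta_z3; have s2 := inv_sqrt3_sq; have s0 := inv_sqrt3_gt0.
rewrite /f_delta -/s in q0 q1 r1 *.
move: (z2 delta) (z3 delta) q0 q1 r1 => q z q0 q1 r1 dz dq.
have E : q ^+ 2 + q * z + z ^+ 2 = 1.
  apply: (mulfI (x := q - z)); first by apply/eqP; lra.
  by lra.
rewrite ltNge; apply/negP => qz.
(* The two products add up to [q ^+ 2 + q * z + z ^+ 2 - 3 * s ^+ 2 = 0], but [2 * q + z <= 0] makes
   the first negative and the second nonpositive. *)
have h1 : (q + s) * (q - s + z) = q ^+ 2 + q * z - s ^+ 2 + s * z by ring.
have h2 : (z - 2 * s) * (z + s) = z ^+ 2 - s * z - 2 * s ^+ 2 by ring.
have h3 : (q + s) * (q - s + z) < 0 by rewrite pmulr_rlt0; lra.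
have h4 : (z - 2 * s) * (z + s) <= 0 by rewrite mulr_le0_ge0; lra.
by lra.
Qed.

Section Solution.
Context {N : nat}.
Notation V := 'rV[R]_N.
Implicit Types x y e : V.
Variables (u : V -> R) (rho : R).
Hypothesis uC : C2 u.
Hypothesis cu : continuous u.
Hypothesis ueq : forall x, laplacian u x = u x ^+ 3 - u x + delta.
Hypothesis u_gt : forall x, rho <= sq x -> z2 delta < u x.

Let ulap x : is_lap u x (u x ^+ 3 - u x + delta).
Proof. by rewrite -ueq; exact: is_lap_C2. Qed.

Let ulapR e l x : sq e = 1 ->
  is_lap (fun y => u (mirror e l y)) x (u (mirror e l x) ^+ 3 - u (mirror e l x) + delta).
Proof. by move=> e1; rewrite -ueq; exact: is_lap_mirror. Qed.

Lemma solution_le_z3 x : u x <= z3 delta.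
Proof.
apply: (keller_osserman cu ulap) => {}x.
have := delta_z3; have := z3_gt; have := inv_sqrt3_gt0; have := inv_sqrt3_sq.
move: (u x) (z3 delta) => t z s2 s0 sz -> zt.
rewrite -subr_ge0; have -> : t ^+ 3 - t + (z - z ^+ 3) - (t - z) ^+ 3 = (t - z) * (3 * (t * z) - 1).
  by ring.
apply: mulr_ge0; rewrite subr_ge0; first exact: ltW.
have : s ^+ 2 <= t * z by rewrite expr2; apply: ler_pM; lra.
by lra.
Qed.

(** The same barrier applied to [- u] with the crude level [2]; together with [solution_le_z3] it
    bounds [|u|]. *)
Lemma solution_ge_N2 x : -2 <= u x.
Proof.
rewrite lerNl; apply: (@keller_osserman _ _ (fun x => - u x) (fun x => - (u x ^+ 3 - u x + delta))).
- by under eq_fun do rewrite -sub0r; apply: continuous_subf => //; exact: cst_continuous.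
- move=> y; have := is_lapZ (-1) (ulap y).
  by rewrite mulN1r; under eq_fun do rewrite mulN1r.
move=> y; have := norm_delta_le1; rewrite ler_norml => /andP[d1 d2].
move: (u y) => t t2; have -> : t = - (- t) by rewrite opprK.
by move: (- t) t2 => r r2; nra.
Qed.

Lemma solution_limit eps : 0 < eps ->
  exists r, forall x, r <= sq x -> z3 delta - eps <= u x.
Proof.
move=> eps0; have m0' := z2_z3_gt0.
(* Where [z2 < u <= z3 - eps], the factorization gives [lap u <= - m * (u - z2)]; [r] below is then
   large enough for the bump comparison. *)
pose m := (2 * z2 delta + z3 delta) * eps.
have m0 : 0 < m by rewrite mulr_gt0.
pose r := ((N%:R + 2) ^+ 2 + 1) / (2 * m).
have n0 : 0 < (N%:R + 2) ^+ 2 + 1 :> R by rewrite ltr_wpDl // sqr_ge0.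
have r0 : 0 < r by rewrite divr_gt0 // mulr_gt0.
(* From this threshold on, the ball of squared radius [r] about [x0] stays in the region
   [rho <= sq x]. *)
exists (2 * r + 2 * rho) => x0 x0r.
have inball x : sq (x - x0) <= r -> z2 delta < u x.
  move=> xr; apply: u_gt; have : sq (x0 - x) <= r by rewrite -sqN opprB.
  by move=> /(sqB_le (ltW r0)); lra.
suff : z3 delta - z2 delta - eps <= u x0 - z2 delta by lra.
have cv : continuous (fun x => u x - z2 delta).
  by apply: continuous_subf => //; exact: cst_continuous.
have vL x := is_lapB (ulap x) (is_lap_cst (z2 delta) x).
apply: (positive_supersolution_ge cv vL r0 m0).
- by rewrite /r mulrC divfK ?ltrDl // gt_eqF // mulr_gt0.
- by move=> x /inball; rewrite subr_gt0.
move=> x /inball ux uT; rewrite subr0 f_delta_factor /m.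
move: (z2 delta) (z3 delta) (u x) m0' ux uT => q z t qz qt tT.
have h1 : 0 < (t - q) * (2 * q + z) by rewrite mulr_gt0 // subr_gt0.
have h2 : (t - q) * (2 * q + z) <= (t - q) * (t + q + z).
  by rewrite ler_pM2l ?subr_gt0 //; lra.
by nra.
Qed.

Lemma solution_radial : exists x0, forall x y, sq (x - x0) = sq (y - x0) -> u x = u y.
Proof.
apply: (@reflections_radial _ _ u (z3 delta)); last first.
  move=> eps eps0; have [r rP] := solution_limit eps0; exists r => x /rP ux.
  by have := solution_le_z3 x; rewrite ler_norml; lra.
move=> e e1.
apply: (@moving_planes _ _ u delta (z3 delta) s (z3 delta + 2)) => //.
- move=> x; have := solution_le_z3 x; have := solution_ge_N2 x.
  have := z3_gt; have := inv_sqrt3_gt0; rewrite ler_norml; lra.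
- exact: solution_le_z3.
- exact: inv_sqrt3_gt0.
- exact: inv_sqrt3_sq.
- exact: z3_gt.
- exact: solution_limit.
Qed.

Lemma solution_constant : (2 <= N)%N -> delta <= 0 -> forall x, u x = z3 delta.
Proof.
move=> N2 d0 x; have [x0 urad] := solution_radial.
have i0 : 'I_N := Ordinal (ltnW N2).
set e : V := delta_mx 0 i0.
(* Here the sign of [delta] enters: [z - z ^+ 3 = delta <= 0] with [z > 0] forces [z >= 1], which
   makes [z3] a global maximum of the potential. *)
have z1 : 1 <= z3 delta.
  have := delta_z3; have := z3_gt; have := inv_sqrt3_gt0; move: d0; move: (z3 delta) => z.
  move=> d0 s0 sz dz; rewrite leNgt; apply/negP => z1.
  have : 0 < z * (1 - z) * (1 + z) by rewrite !mulr_gt0; lra.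
  have -> : z * (1 - z) * (1 + z) = z - z ^+ 3 by ring.
  by lra.
pose phi r := u (x0 + r *: e).
have offset r : x0 + r *: e - x0 = r *: e by rewrite addrAC subrr add0r.
have -> : u x = phi (enorm (x - x0)) := radial_profile i0 urad x.
pose phi1 r := 'D_e u (x0 + r *: e).
pose phi2 r := hess u (x0 + r *: e) e e.
have phiD (r : R) : is_derive r (1 : R) phi (phi1 r).
  by apply: is_derive_line; have [[]] := uC e.
have phi1D (r : R) : is_derive r (1 : R) phi1 (phi2 r).
  by apply: is_derive_line; have [_ /(_ e)[]] := uC e.
have phi_even r : phi (- r) = phi r.
  by apply: urad; rewrite !offset !sqZ sqrrN.
apply: (@energy_rigidity _ phi phi1 phi2 delta (z3 delta) (z3 delta + 2) N.-1%:R) => //.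
(* The profile along the full line is even, so its derivative vanishes at [0]. *)
- have D : is_derive (0 : R) (1 : R) (phi \o -%R) (phi1 (- 0) * -1).
    exact: is_derive1_comp.
  have E : phi \o -%R = phi by apply/funext.
  rewrite E oppr0 in D; have [_ D1] := D; have [_] := phiD 0; rewrite D1; lra.
- by rewrite ltr0n -subn1 subn_gt0.
- move=> r r0; rewrite /phi -ueq (radial_laplacian i0 uC urad r0).
  by congr (_ + _); exact: mulr_natl.
- exact: delta_z3.
- move=> r; have := solution_le_z3 (x0 + r *: e); have := solution_ge_N2 (x0 + r *: e).
  rewrite /phi ler_norml; lra.
- move=> eps eps0; have [r rP] := solution_limit eps0.
  exists (`|r| + 1 + `|dot x0 e|) => q qr.
  have := solution_le_z3 (x0 + q *: e); have := rP (x0 + q *: e).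
  have e1 : sq e = 1 := sq_delta i0.
  have xr : r <= sq (x0 + q *: e).
    apply: le_trans (dot_unit_le _ e1); apply: le_sqr_of_succ_le.
    rewrite dotDl dotZl -/(sq e) e1; have := ler_norm (- dot x0 e); rewrite normrN; lra.
  by move=> /(_ xr) h1 h2; rewrite /phi ler_norml; lra.
exact: sqrtr_ge0.
Qed.

End Solution.
End Roots.

Theorem theorem1 (R : realType) (N : nat) (delta : R) (u : 'rV[R]_N -> R)
  (rho : R)
  (N_ge2 : (2 <= N)%N)
  (delta_range : - delta_bound R < delta < delta_bound R)
  (u_sol : classical_solution delta u)
  (rho_gt0 : 0 < rho)
  (u_gt_z2 : forall x : 'rV[R]_N, rho <= enorm x -> z2 delta < u x) :
  (delta <= 0 -> forall x : 'rV[R]_N, u x = z3 delta) /\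
  (0 < delta -> radially_symmetric u).
Proof.
have [uCk ueq] := u_sol.
have uC := is_Ck2_C2 uCk; have [cu _] := uCk.
have ueq' x : laplacian u x = u x ^+ 3 - u x + delta.
  by have := ueq x; move: (laplacian u x) => L; lra.
have ugt x : rho ^+ 2 <= sq x -> z2 delta < u x.
  by move=> xr; apply: u_gt_z2; rewrite le_enorm // ltW.
split=> [d0|_]; first exact: (solution_constant delta_range uC cu ueq' ugt).
have [x0 urad] := solution_radial delta_range uC cu ueq' ugt.
pose i0 := Ordinal (ltnW N_ge2).
exists x0, (fun r => u (x0 + r *: delta_mx 0 i0)); exact: radial_profile.
Qed.
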